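(* Let $G$ be a connected graph such that every end $\omega$ of $G$ has a local end-faithful normal tree, i.e.\ there is a normal tree $T$ in $G$ such that $\partial_\Omega T$ is a neighbourhood of $\omega$ in $\Omega(G)$. Then $G$ has an end-faithful normal tree.
   Context: Ends of $G$: equivalence classes of rays (one-way infinite paths), two rays being equivalent if no finite vertex set separates them; $\Omega(G)$ is the set of ends, topologised by the basis of sets $\Omega(X,C)$ of ends having a tail of each of their rays in $C$, for finite $X \subseteq V(G)$ and $C$ a component of $G-X$; $C(X,\omega)$ is the component of $G - X$ containing a tail of every ray of $\omega$. For a subgraph $H$, $\partial_\Omega H$ is the set of ends $\omega$ with $C(X,\omega) \cap H \neq \emptyset$ for every finite $X \subseteq V(G)$. A rooted tree $T \subseteq G$ is normal if the endvertices of every $T$-path in $G$ (non-trivial path meeting $T$ only in its endvertices) are comparable in its tree-order. $H \subseteq G$ is end-faithful if the natural map $\Omega(H) \to \Omega(G)$ (sending the end of $H$ containing a ray to the end of $G$ containing it) is a bijection. *)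

(* Defs.v *)
From HB Require Import structures.
From mathcomp Require Import all_boot.
From mathcomp Require Import all_classical.
From mathcomp Require Import topology.

Set Implicit Arguments.
Unset Strict Implicit.
Unset Printing Implicit Defensive.

Local Open Scope classical_set_scope.

(* Simple graphs of arbitrary cardinality.  The vertex set is a subset of an
   ambient type, so that a graph and its subgraphs have the same type and all
   notions below apply to both. *)
Record graph (V : Type) := Graph {
  verts : set V;
  edge : V -> V -> Prop;
  edge_sym : forall u v, edge u v -> edge v u;
  edge_irrefl : forall u, ~ edge u u;
  edge_verts : forall u v, edge u v -> verts u
}.

Section Graphs.
Variable V : Type.
Implicit Types (G H T : graph V) (X A B C : set V) (p r s : nat -> V).

Definition subgraph H G : Prop :=
  verts H `<=` verts G /\ (forall u v, edge H u v -> edge G u v).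

(* The path p 0, ..., p n of length n; the values of p beyond n are junk. *)
Definition is_path G p (n : nat) : Prop :=
  [/\ verts G (p 0),
      (forall i, i < n -> edge G (p i) (p i.+1)) &
      (forall i j, i <= n -> j <= n -> p i = p j -> i = j)].

Definition linked G (u v : V) : Prop :=
  exists p n, [/\ is_path G p n, p 0 = u & p n = v].

Definition graph_connected G : Prop :=
  verts G !=set0 /\ (forall u v, verts G u -> verts G v -> linked G u v).

(* The cycle p 0, ..., p n, p 0 has n.+1 >= 3 vertices. *)
Definition is_cycle G p (n : nat) : Prop :=
  [/\ is_path G p n, 2 <= n & edge G (p n) (p 0)].

Definition is_tree T : Prop :=
  graph_connected T /\ (forall p n, ~ is_cycle T p n).

(* The order of the tree T rooted at x0: u lies on the path x0 T v. *)
Definition tree_le T (x0 u v : V) : Prop :=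
  exists p n, [/\ is_path T p n, p 0 = x0, p n = v
                & exists2 i, i <= n & p i = u].

Definition is_Hpath G H p (n : nat) : Prop :=
  [/\ is_path G p n, 0 < n
    & forall i, i <= n -> (verts H (p i) <-> i = 0 \/ i = n)].

Definition normal_tree G T (x0 : V) : Prop :=
  [/\ subgraph T G, is_tree T, verts T x0
    & forall p n, is_Hpath G T p n ->
        tree_le T x0 (p 0) (p n) \/ tree_le T x0 (p n) (p 0)].

Definition del G X : graph V.
Proof.
refine {| verts := verts G `\` X;
          edge := fun u v => [/\ edge G u v, ~ X u & ~ X v] |}.
- by move=> u v [e Xu Xv]; split=> //; exact: edge_sym.
- by move=> u [e _ _]; exact: edge_irrefl e.
- by move=> u v [e Xu _]; split=> //; exact: edge_verts e.
Defined.

Definition is_component G C : Prop :=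
  exists2 u, verts G u & C = [set v | linked G u v].

Definition separates G X A B : Prop :=
  forall p n, is_path G p n -> A (p 0) -> B (p n) ->
    exists2 i, i <= n & X (p i).

Definition is_ray G r : Prop :=
  injective r /\ (forall n, edge G (r n) (r n.+1)).

Definition tail_in r C : Prop := exists n, forall m, n <= m -> C (r m).

Definition ray_equiv G r s : Prop :=
  forall X, finite_set X -> X `<=` verts G ->
    ~ separates G X (range r) (range s).

Record ends G := End {
  rays_of : set (nat -> V);
  rays_ofP : exists2 r, is_ray G r
               & rays_of = [set s | is_ray G s /\ ray_equiv G r s]
}.

Definition end_of G r (rayr : is_ray G r) : ends G :=
  @End G [set s | is_ray G s /\ ray_equiv G r s]
    (ex_intro2 _ _ r rayr (erefl _)).

Lemma eq_end G (w w' : ends G) : rays_of w = rays_of w' -> w = w'.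
Proof.
case: w w' => [A PA] [B PB] /= AB; subst B; congr End; exact: Prop_irrelevance.
Qed.

Lemma sub_ray H G r : subgraph H G -> is_ray H r -> is_ray G r.
Proof. by move=> [_ HG] [? rH]; split=> // n; apply: HG. Qed.

(* The natural map from the ends of H to the ends of G: it picks a ray of the
   given end of H; end_map_end_of shows that the choice is irrelevant. *)
Definition end_map H G (HG : subgraph H G) (w : ends H) : ends G :=
  let: exist2 r rayr _ := cid2 (rays_ofP w) in end_of (sub_ray HG rayr).

Definition end_faithful H G : Prop :=
  exists HG : subgraph H G, bijective (end_map HG).

(* Omega(X, C), which depends on X only through C being a component of G - X. *)
Definition end_basic G C : set (ends G) :=
  [set w : ends G | forall r, rays_of w r -> tail_in r C].

(* C(X, w), meaningful for finite X: see end_compP and end_comp_unique. *)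
Definition end_comp G X (w : ends G) : set V :=
  xget set0 [set C | is_component (del G X) C
                     /\ (forall r, rays_of w r -> tail_in r C)].

Definition end_boundary G H : set (ends G) :=
  [set w : ends G | forall X, finite_set X -> X `<=` verts G ->
     end_comp X w `&` verts H !=set0].

Arguments end_basic G C : clear implicits.
Arguments end_boundary G H : clear implicits.

Lemma linked_refl G u : verts G u -> linked G u u.
Proof.
move=> Gu; exists (fun=> u), 0; split=> //; split=> // i j.
by rewrite !leqn0 => /eqP-> /eqP->.
Qed.

Lemma linked_edge G u v w : linked G u v -> edge G v w -> linked G u w.
Proof.
move=> [p [n [[p0 pe pI] <- <-]]] ew.
have [[i [lein <-]]|nw] := pselect (exists i, i <= n /\ p i = w).
  exists p, i; split=> //; split=> // [j ji|j k ji ki].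
    by apply: pe; apply: leq_trans lein.
  by apply: pI; [apply: leq_trans ji lein|apply: leq_trans ki lein].
exists (fun i => if i <= n then p i else w), n.+1.
rewrite ltnn; split=> //; split=> [//|i|i j].
  rewrite ltnS => lein; rewrite lein.
  by case: ltnP => [/pe //|nlei]; rewrite (@anti_leq i n) // lein nlei.
rewrite (leq_eqVlt i) (leq_eqVlt j) !ltnS.
move=> /predU1P[->|ilen] /predU1P[->|jlen] //; rewrite ?ltnn ?ilen ?jlen.
- by move=> E; case: nw; exists j.
- by move=> E; case: nw; exists i.
- exact: pI.
Qed.

Lemma linked_trans G u v w : linked G u v -> linked G v w -> linked G u w.
Proof.
move=> uv [p [n [[_ pe _] pv <-]]]; move: uv; rewrite -{}pv => uv.
have: forall i, i <= n -> linked G u (p i); last exact.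
elim=> [//|i IH lt_in]; exact: linked_edge (IH (ltnW lt_in)) (pe _ lt_in).
Qed.

Lemma path_verts G p n i : is_path G p n -> i <= n -> verts G (p i).
Proof.
move=> [p0 pe _]; case: i => // i lt_in.
exact: edge_verts (edge_sym (pe _ lt_in)).
Qed.

Lemma linked_verts G u v : linked G u v -> verts G u /\ verts G v.
Proof.
by move=> [p [n [pP <- <-]]]; split; apply: path_verts (pP) _.
Qed.

Lemma linked_sym G u v : linked G u v -> linked G v u.
Proof.
move=> [p [n [pP <- <-]]].
have: forall i, i <= n -> linked G (p i) (p 0); last exact.
have [p0 pe _] := pP.
elim=> [_|i IH lt_in]; first exact: linked_refl.
apply: linked_trans (IH (ltnW lt_in)).
apply: (linked_edge (linked_refl (path_verts pP lt_in))).
exact/edge_sym/pe.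
Qed.

Lemma sub_path H G p n : subgraph H G -> is_path H p n -> is_path G p n.
Proof. by move=> [HV HE] [p0 pe pI]; split=> //; [exact: HV|move=> i /pe/HE]. Qed.

Lemma sub_linked H G u v : subgraph H G -> linked H u v -> linked G u v.
Proof. by move=> HG [p [n [/(sub_path HG) pP ? ?]]]; exists p, n. Qed.

Lemma sub_del G X Y : X `<=` Y -> subgraph (del G Y) (del G X).
Proof.
move=> XY; split=> [u [Gu Yu]|u v [e Yu Yv]] /=.
  by split=> // /XY.
by split=> // /XY.
Qed.

Lemma path_del G X p n :
  is_path G p n -> (forall i, i <= n -> ~ X (p i)) -> is_path (del G X) p n.
Proof.
move=> [p0 pe pI] pX; split=> //=; first by split=> //; apply: pX.
by move=> i lt_in; split; [exact: pe|apply: pX; exact: ltnW|exact: pX].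
Qed.

Lemma del_sub G X : subgraph (del G X) G.
Proof. by split=> [u []|u v []]. Qed.

Lemma nseparatesP G X A B : ~ separates G X A B <->
  exists u v, [/\ A u, B v & linked (del G X) u v].
Proof.
split=> [nsep|[u [v [Au Bv [p [n [pP pu pv]]]]]] sep].
  apply: contrapT => nl; apply: nsep => p n pP Ap Bp.
  apply: contrapT => nX; apply: nl; exists (p 0), (p n); split=> //.
  exists p, n; split=> //; apply: path_del => // i lein Xi.
  by apply: nX; exists i.
have [||i lein] := sep p n (sub_path (@del_sub G X) pP); rewrite ?pu ?pv //.
by have [] := path_verts pP lein.
Qed.

Lemma ray_verts G r n : is_ray G r -> verts G (r n).
Proof. by move=> rG; exact: edge_verts (rG.2 n). Qed.

Lemma ray_avoid r X : injective r -> finite_set X ->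
  exists N, forall m, N <= m -> ~ X (r m).
Proof.
move=> rI fX; have /finite_seqP[s sE] : finite_set (r @^-1` X).
  by apply: finite_preimage => // i j _ _; apply: rI.
exists (\max_(i <- s) i).+1 => m lem Xm.
have : m \in s by have : [set` s] m by rewrite -sE.
move=> ms; have := @leq_bigmax_seq _ s xpredT id m ms isT.
by rewrite leqNgt lem.
Qed.

Lemma ray_linked G r X N : is_ray G r -> (forall m, N <= m -> ~ X (r m)) ->
  forall m k, N <= m -> N <= k -> linked (del G X) (r m) (r k).
Proof.
move=> rG rX.
have h k : linked (del G X) (r N) (r (N + k)).
  elim: k => [|k IH].
    by rewrite addn0; apply: linked_refl; split; [exact: ray_verts|exact: rX].
  rewrite addnS; apply: (linked_edge IH); case: rG => _ rE.
  by split; [exact: rE|apply: rX; exact: leq_addr|apply: rX; rewrite -addnS leq_addr].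
by move=> m k /subnKC <- /subnKC <-; apply: linked_trans (linked_sym (h _)) (h _).
Qed.

Lemma ray_equiv_linked G r s X : is_ray G r -> is_ray G s -> ray_equiv G r s ->
  finite_set X -> X `<=` verts G ->
  exists N, forall m k, N <= m -> N <= k -> linked (del G X) (r m) (s k).
Proof.
move=> rG sG rs fX XG.
have [N1 H1] := ray_avoid rG.1 fX; have [N2 H2] := ray_avoid sG.1 fX.
pose N := maxn N1 N2; exists N => m k lem lek.
have rX i : N <= i -> ~ X (r i).
  by move=> le; apply: H1; apply: leq_trans le; exact: leq_maxl.
have sX i : N <= i -> ~ X (s i).
  by move=> le; apply: H2; apply: leq_trans le; exact: leq_maxr.
have := rs (X `|` (r @` `I_N `|` s @` `I_N)); case/(_ _ _)/nseparatesP.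
- by rewrite !finite_setU; split=> //; split; apply: finite_image.
- by move=> x [/XG //|[[i _ <-]|[i _ <-]]]; exact: ray_verts.
move=> _ [_ [[a _ <-] [b _ <-] ab]].
have [[_ Xa] [_ Xb]] := linked_verts ab.
have Na : N <= a.
  by rewrite leqNgt; apply/negP => lta; apply: Xa; right; left; exists a.
have Nb : N <= b.
  by rewrite leqNgt; apply/negP => ltb; apply: Xb; right; right; exists b.
apply: linked_trans (ray_linked rG rX lem Na) _.
apply: linked_trans (ray_linked sG sX Nb lek).
by apply: sub_linked ab; apply: sub_del => x Xx; left.
Qed.

Lemma linked_ray_equiv G r s :
  (forall X, finite_set X -> X `<=` verts G ->
     exists m k, linked (del G X) (r m) (s k)) -> ray_equiv G r s.
Proof.
move=> h X fX XG; have [m [k mk]] := h X fX XG.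
by apply/nseparatesP; exists (r m), (s k); split=> //.
Qed.

Lemma ray_equiv_refl G r : is_ray G r -> ray_equiv G r r.
Proof.
move=> rG; apply: linked_ray_equiv => X fX _.
have [N rX] := ray_avoid rG.1 fX; exists N, N; exact: (ray_linked rG rX).
Qed.

Lemma ray_equiv_sym G r s :
  is_ray G r -> is_ray G s -> ray_equiv G r s -> ray_equiv G s r.
Proof.
move=> rG sG rs; apply: linked_ray_equiv => X fX XG.
have [N h] := ray_equiv_linked rG sG rs fX XG.
by exists N, N; apply/linked_sym/h.
Qed.

Lemma ray_equiv_trans G r s t : is_ray G r -> is_ray G s -> is_ray G t ->
  ray_equiv G r s -> ray_equiv G s t -> ray_equiv G r t.
Proof.
move=> rG sG tG rs st; apply: linked_ray_equiv => X fX XG.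
have [N h] := ray_equiv_linked rG sG rs fX XG.
have [M k] := ray_equiv_linked sG tG st fX XG.
exists N, M; apply: (@linked_trans _ _ (s (maxn N M))).
  by apply: h => //; exact: leq_maxl.
by apply: k => //; exact: leq_maxr.
Qed.

Lemma end_of_equiv G r s (rG : is_ray G r) (sG : is_ray G s) :
  ray_equiv G r s -> end_of rG = end_of sG.
Proof.
move=> rs; apply: eq_end; apply/seteqP; split=> t [tG rt]; split=> //.
  exact: ray_equiv_trans (ray_equiv_sym rG sG rs) rt.
exact: ray_equiv_trans rs rt.
Qed.

Lemma sub_ray_equiv H G r s : subgraph H G -> is_ray H r -> is_ray H s ->
  ray_equiv H r s -> ray_equiv G r s.
Proof.
move=> HG rH sH rs; apply: linked_ray_equiv => X fX XG.
have fY : finite_set (X `&` verts H) by apply: sub_finite_set fX => x [].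
have [|N h] := ray_equiv_linked rH sH rs fY; first by move=> x [].
exists N, N; apply: sub_linked (h _ _ (leqnn N) (leqnn N)).
case: HG => HV HE; split=> [x [/= Hx nX]|u v [e nu nv]].
  by split; [exact: HV|move=> Xx; apply: nX].
split; first exact: HE.
  by move=> Xu; apply: nu; split=> //; exact: edge_verts e.
by move=> Xv; apply: nv; split=> //; exact: edge_verts (edge_sym e).
Qed.

Lemma end_map_end_of H G (HG : subgraph H G) r (rH : is_ray H r) :
  end_map HG (end_of rH) = end_of (sub_ray HG rH).
Proof.
rewrite /end_map; case: cid2 => s sH /= E; apply: end_of_equiv.
apply: (sub_ray_equiv HG sH rH).
have : [set t | is_ray H t /\ ray_equiv H r t] r.
  by split; [exact: rH|exact: ray_equiv_refl rH].
by rewrite E => -[].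
Qed.

Lemma end_comp_exists G X (w : ends G) : finite_set X -> X `<=` verts G ->
  exists C, is_component (del G X) C /\ (forall r, rays_of w r -> tail_in r C).
Proof.
move=> fX XG; have [r rG ->] := rays_ofP w.
have [N rX] := ray_avoid rG.1 fX.
exists [set v | linked (del G X) (r N) v]; split.
  by exists (r N) => //; split; [exact: ray_verts|exact: rX].
move=> s [sG rs]; have [M h] := ray_equiv_linked rG sG rs fX XG.
exists M => k lek /=; apply: linked_trans (h (maxn N M) k (leq_maxr _ _) lek).
by apply: (ray_linked rG rX) => //; exact: leq_maxl.
Qed.

Lemma end_compP G X (w : ends G) : finite_set X -> X `<=` verts G ->
  is_component (del G X) (end_comp X w)
  /\ (forall r, rays_of w r -> tail_in r (end_comp X w)).
Proof.
move=> fX XG; have [C PC] := end_comp_exists w fX XG.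
exact: (@xgetPex _ set0 [set C | is_component (del G X) C
  /\ (forall r, rays_of w r -> tail_in r C)] (ex_intro _ C PC)).
Qed.

Lemma end_ray G (w : ends G) : exists r, rays_of w r.
Proof.
have [r rG ->] := rays_ofP w; exists r; split=> //; exact: ray_equiv_refl.
Qed.

Lemma sub_component G X Y C D v : X `<=` Y ->
  is_component (del G X) C -> is_component (del G Y) D -> C v -> D v ->
  D `<=` C.
Proof.
move=> XY [u _ ->] [u' _ ->] /= uv u'v x /= u'x.
apply: linked_trans uv _; apply: sub_linked (sub_del _ XY) _.
exact: linked_trans (linked_sym u'v) u'x.
Qed.

Lemma tail_in_meet r A B : tail_in r A -> tail_in r B -> exists v, A v /\ B v.
Proof.
move=> [n h] [m k]; exists (r (maxn n m)).
by split; [apply: h; exact: leq_maxl|apply: k; exact: leq_maxr].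
Qed.

Lemma end_comp_unique G X (w : ends G) C : finite_set X -> X `<=` verts G ->
  is_component (del G X) C -> (forall r, rays_of w r -> tail_in r C) ->
  C = end_comp X w.
Proof.
move=> fX XG cC wC; have [cD wD] := end_compP w fX XG.
have [r wr] := end_ray w; have [v [Cv Dv]] := tail_in_meet (wC r wr) (wD r wr).
by apply/seteqP; split; [apply: sub_component cD cC Dv Cv
                        |apply: sub_component cC cD Cv Dv].
Qed.

Definition end_index G : set (set V * set V) :=
  [set XC | [/\ finite_set XC.1, XC.1 `<=` verts G
              & is_component (del G XC.1) XC.2]].

Lemma end_basic_cover G :
  \bigcup_(XC in end_index G) end_basic G XC.2 = setT.
Proof.
rewrite -subTset => w _.
have f0 : finite_set (set0 : set V) by exact: finite_set0.
have [cC wC] := end_compP w f0 (@sub0set _ _).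
exists (set0, end_comp set0 w); last exact: wC.
by split=> //; exact: sub0set.
Qed.

Lemma end_basic_join G (i j : set V * set V) (w : ends G) :
  end_index G i -> end_index G j ->
  end_basic G i.2 w -> end_basic G j.2 w ->
  exists k, [/\ end_index G k, end_basic G k.2 w
    & end_basic G k.2 `<=` end_basic G i.2 `&` end_basic G j.2].
Proof.
case: i j => [X C] [Y D] [/= fX XG cC] [/= fY YG cD] wC wD.
have fXY : finite_set (X `|` Y) by rewrite finite_setU.
have XYG : X `|` Y `<=` verts G by rewrite subUset.
have [cE wE] := end_compP w fXY XYG.
have [r wr] := end_ray w.
have EC : end_comp (X `|` Y) w `<=` C.
  have [v [Cv Ev]] := tail_in_meet (wC r wr) (wE r wr).
  exact: sub_component cC cE Cv Ev.
have ED : end_comp (X `|` Y) w `<=` D.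
  have [v [Dv Ev]] := tail_in_meet (wD r wr) (wE r wr).
  exact: sub_component cD cE Dv Ev.
exists (X `|` Y, end_comp (X `|` Y) w); split=> // z zE.
by split=> s /zE[n h]; exists n => m /h; [exact: EC|exact: ED].
Qed.

End Graphs.

Arguments end_basic {V} G C.
Arguments end_boundary {V} G H.

HB.instance Definition _ (V : Type) (G : graph V) := gen_eqMixin (ends G).
HB.instance Definition _ (V : Type) (G : graph V) := gen_choiceMixin (ends G).
HB.instance Definition _ (V : Type) (G : graph V) :=
  @isBaseTopological.Build (ends G) (set V * set V)%type (@end_index V G)
    (fun XC => end_basic G XC.2) (@end_basic_cover V G)
    (@end_basic_join V G).

(* Main.v *)
(* Call a set of vertices dispersed if no ray has it in its closure, and call a
   set A good if some countable union of dispersed sets has all rays of A in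
   its closure.  The levels of a normal tree are dispersed, so by hypothesis
   every end has a good neighbourhood.

   Suppose G is bad.  A bad region stays bad, in some component, when finitely
   many vertices are deleted.  In a bad region L with a vertex x, some finite Y is not
   contained in any good component at x of L minus a finite set: otherwise L
   would be a countable union of good sets with finite boundary, and following
   bad components of the complements of these yields a ray whose end has no
   good neighbourhood.  Now follow bad regions, deleting at every step a finite
   connected set containing x and such a Y; these sets carry a ray, and a good
   neighbourhood of its end contains one of the sets Y, a contradiction.

   So there are dispersed sets U_0, U_1, ... whose union has every end in its
   closure.  Grow a depth-first search tree T, in each component D of the rest
   choosing the vertex nearest to the U_i of least index i meeting D.  If an
   end were not in the closure of T, the search would follow it along a ray
   having in its closure the U_i whose index is eventually chosen.  Finally, a
   normal tree with all ends in its closure is end-faithful. *)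
Require Import Defs.
From mathcomp Require Import all_boot.
From mathcomp Require Import all_classical.
From mathcomp Require Import topology.

Set Implicit Arguments.
Unset Strict Implicit.
Unset Printing Implicit Defensive.

Local Open Scope classical_set_scope.

Lemma finite_eventually (T : Type) (X : set T) (P : T -> nat -> Prop) :
  finite_set X -> (forall x, X x -> exists n, forall m, n <= m -> P x m) ->
  exists n, forall m, n <= m -> forall x, X x -> P x m.
Proof.
move=> fX h.
(* [{classic T}] gives an arbitrary type decidable equality, so [X] can be listed by a sequence. *)
have /finite_seqP[s sE] : finite_set (X : set {classic T}) by [].
have {sE} : forall x : {classic T}, X x -> x \in s.
  by move=> x; rewrite sE.
elim: s X {fX} h => [|a s IH] X h Xs.
  by exists 0 => m _ x /Xs.
have [||n hn] := IH (X `&` [set x | x <> a]).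
- by move=> x [/h].
- by move=> x [/Xs]; rewrite inE => /orP[/eqP|].
have [Xa|Xa] := pselect (X a); last first.
  by exists n => m le x Xx; apply: hn => //; split=> // xa; apply: Xa; rewrite -xa.
have [k hk] := h a Xa; exists (maxn n k) => m; rewrite geq_max => /andP[nm km] x Xx.
by have [->|xa] := pselect (x = a); [exact: hk|exact: hn].
Qed.

(** * Linkage *)
Section Linked.
Variable V : Type.
Implicit Types (G : graph V) (P Q X Y F D S : set V).

Lemma linked_ind G u v P :
  linked G u v -> P u -> (forall a b, P a -> edge G a b -> P b) -> P v.
Proof.
move=> [p [n [[_ pe _] <- <-]]] P0 PS.
suff: forall i, i <= n -> P (p i) by apply.
by elim=> // i IH lt; apply: PS (IH (ltnW lt)) (pe _ lt).
Qed.

Lemma edge_linked G u v : edge G u v -> linked G u v.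
Proof. by move=> e; apply: linked_edge (linked_refl (edge_verts e)) e. Qed.

Lemma linked_del_sub G X Y u v :
  X `<=` Y -> linked (del G Y) u v -> linked (del G X) u v.
Proof. by move=> XY; apply/sub_linked/sub_del. Qed.

Lemma linked_delI G X u v :
  linked (del G (X `&` verts G)) u v -> linked (del G X) u v.
Proof.
apply: sub_linked; split=> [a [Ga nX]|a b [e nXa nXb]].
  by split=> // Xa; apply: nX.
have Gb := edge_verts (edge_sym e).
by split=> // Xc; [apply: nXa|apply: nXb]; split=> //; exact: edge_verts e.
Qed.

(** The least such [k] serves as the distance from [v] to [S] within [D]; walks suffice for this,
    and [v] itself need not lie in [D]. *)
Fixpoint steps_to G D S k (v : V) : Prop :=
  if k is j.+1 then exists w, [/\ D w, edge G v w & steps_to G D S j w] else S v.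

Lemma linked_steps_to G D S u v :
  linked (del G (~` D)) u v -> S v -> exists k, steps_to G D S k u.
Proof.
move=> uv Sv.
apply: (@linked_ind _ _ _ [set w | exists k, steps_to G D S k w] (linked_sym uv)).
  by exists 0.
move=> a b [k ka] [e /contrapT Da _]; exists k.+1, a; split=> //.
exact: edge_sym.
Qed.

(** If the walk passed through [v], its remainder would lead from [v] to [S] in at most [k]
    steps. *)
Lemma steps_to_avoid G D S k v w : steps_to G D S k w ->
  (forall j, j <= k -> ~ steps_to G D S j v) -> steps_to G (D `\ v) S k w.
Proof.
elim: k w => // k IH w [w' [Dw' e nw']] nv; exists w'; split=> //.
  by split=> // E; apply: (nv k) => //; rewrite -E.
by apply: IH nw' _ => j le; apply: nv; rewrite ltnW.
Qed.

Lemma steps_to_linked G D S k w : verts G w -> D w -> steps_to G D S k w ->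
  exists2 u, S u & linked (del G (~` D)) w u.
Proof.
elim: k w => [|k IH] w Gw Dw /=.
  by exists w => //; apply: linked_refl; split=> //= nD.
move=> [w' [Dw' e /IH[]//]]; first exact: edge_verts (edge_sym e).
move=> u Su l; exists u => //; apply: linked_trans l.
by apply: edge_linked; split=> // /(_ _).
Qed.

Lemma steps_to_min G D S v : (exists k, steps_to G D S k v) ->
  exists k, steps_to G D S k v /\ forall j, steps_to G D S j v -> k <= j.
Proof.
move=> [k nk].
have ex : exists k, `[< steps_to G D S k v >] by exists k; apply/asboolP.
have [m /asboolP nm min] := ex_minnP ex.
by exists m; split=> // j nj; apply: min; apply/asboolP.
Qed.

End Linked.

(** * Components and good sets *)
Section Components.
Variables (V : Type) (G : graph V).
Implicit Types (F X Y Z A B D : set V) (r : nat -> V).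

(** The component of [G - F] at [x], empty if [x] is not a vertex of [G - F]; so [cmp F x x] says
    that [x] is one. *)
Definition cmp F x : set V := [set v | linked (del G F) x v].

Lemma cmp_refl F x : verts G x -> ~ F x -> cmp F x x.
Proof. by move=> Gx Fx; apply: linked_refl. Qed.

Lemma cmp_start F x y : cmp F x y -> cmp F x x.
Proof. by move=> xy; have [? _] := linked_verts xy; exact: linked_refl. Qed.

Lemma cmp_end F x y : cmp F x y -> verts G y /\ ~ F y.
Proof. by move=> xy; have [_ []] := linked_verts xy. Qed.

Lemma cmp_eq F x y : cmp F x y -> cmp F x = cmp F y.
Proof.
move=> xy; apply/seteqP; split=> v; apply: linked_trans => //.
exact: linked_sym.
Qed.

Lemma cmp_sub F F' x y : F `<=` F' -> cmp F x y -> cmp F' y `<=` cmp F x.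
Proof.
move=> FF xy v yv; apply: linked_trans xy _; exact: linked_del_sub yv.
Qed.

Lemma cmp_avoid F Z x : (forall v, cmp F x v -> ~ Z v) ->
  cmp F x `<=` cmp (F `|` Z) x.
Proof.
move=> nZ v xv.
apply: (@linked_ind _ _ _ _ (cmp (F `|` Z) x) xv).
  have xx := cmp_start xv; have [Gx Fx] := cmp_end xx.
  by apply: cmp_refl => // -[//|]; exact: nZ.
move=> a b xa ab; have xa' : cmp F x a by apply: linked_del_sub xa => w; left.
have xb' : cmp F x b := linked_edge xa' ab.
apply: linked_edge xa _; case: ab => e Fa Fb.
by split=> // -[//|]; exact: nZ.
Qed.

Lemma cmp_conn F x : forall u v, cmp F x u -> cmp F x v ->
  linked (del G (~` cmp F x)) u v.
Proof.
have h v : cmp F x v -> linked (del G (~` cmp F x)) x v.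
  move=> xv.
  suff [] : cmp F x v /\ linked (del G (~` cmp F x)) x v by [].
  apply: (@linked_ind _ _ _ _ [set v | cmp F x v
     /\ linked (del G (~` cmp F x)) x v] xv).
    have xx := cmp_start xv; split=> //; apply: linked_refl.
    by have [] := cmp_end xx; split=> //=; exact.
  move=> a b [xa l] ab; have xb : cmp F x b := linked_edge xa ab.
  by split=> //; apply: linked_edge l _; case: ab => e _ _; split=> // /(_ _).
by move=> u v /h xu /h; apply: linked_trans; exact: linked_sym.
Qed.

(** [P] consists of [x] and one path from [x] to each vertex of [Y] in the component. *)
Lemma cmp_finite_conn F x Y : finite_set Y -> cmp F x x ->
  exists P, [/\ finite_set P, P `<=` cmp F x, P x, Y `&` cmp F x `<=` P
    & forall u v, P u -> P v -> linked (del G (~` P)) u v].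
Proof.
move=> fY xx.
have [f fP] : {f : V -> set V & forall y, cmp F x y ->
    [/\ finite_set (f y), f y `<=` cmp F x, f y y
      & forall v, f y v -> linked (del G (~` f y)) x v]}.
  apply: (@choice _ _ (fun y Q => cmp F x y -> [/\ finite_set Q,
     Q `<=` cmp F x, Q y & forall v, Q v -> linked (del G (~` Q)) x v])) => y.
  have [|] := pselect (cmp F x y); last by exists set0.
  move=> [p [n [pP p0 pn]]]; exists (p @` [set i | i <= n]) => _.
  have inQ i : i <= n -> (p @` [set i | i <= n]) (p i) by move=> le; exists i.
  have [[Gp0 _] pe _] := pP.
  have main i : i <= n -> linked (del G F) x (p i)
      /\ linked (del G (~` (p @` [set i | i <= n]))) x (p i).
    elim: i => [_|i IH lt]; first by rewrite p0; split=> //;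
      apply: linked_refl; rewrite -p0; split=> //; apply; exact: inQ.
    have [h1 h2] := IH (ltnW lt); split; first exact: linked_edge h1 (pe _ lt).
    apply: linked_edge h2 _; have [e _ _] := pe _ lt.
    by split=> // /(_ (inQ _ _)); apply => //; exact: ltnW.
  split.
  - by apply: finite_image; exact: finite_II n.+1.
  - by move=> _ [i /main[h _] <-].
  - by rewrite -pn; exact: inQ.
  - by move=> _ [i /main[_ h] <-].
exists ([set x] `|` \bigcup_(y in Y `&` cmp F x) f y); set P := _ `|` _.
have xP v : P v -> linked (del G (~` P)) x v.
  move=> [->|[y Yy yv]].
    apply: linked_refl; split; first by have [] := cmp_end xx.
    by apply; left.
  have [_ _ _ /(_ v yv)] := fP y Yy.2.
  by apply: linked_del_sub => w nP fw; apply: nP; right; exists y.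
split.
- rewrite /P finite_setU; split; first exact: finite_set1.
  apply: bigcup_finite; first by apply: sub_finite_set fY => y [].
  by move=> y [_ /fP[]].
- by move=> v [->//|[y [_ /fP[_ h _ _]] /h]].
- by left.
- by move=> y [Yy xy]; right; exists y => //; have [] := fP y xy.
- by move=> u v /xP xu /xP; apply: linked_trans; exact: linked_sym.
Qed.

(** For a ray [r] and finite [X] this is the component of [G - X] containing a tail of [r]. Unlike
    in [end_comp], no end has to be formed and no component chosen. *)
Definition reach X r : set V :=
  [set v | exists N, forall m, N <= m -> linked (del G X) (r m) v].

Lemma reachE X r : is_ray G r -> finite_set X -> exists N,
  forall n, N <= n -> reach X r = cmp X (r n) /\ reach X r (r n).
Proof.
move=> rG fX; have [N rX] := ray_avoid rG.1 fX; exists N => n le.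
have E : reach X r = cmp X (r n).
  apply/seteqP; split=> v.
    move=> [M h]; apply: linked_trans (h (maxn n M) (leq_maxr _ _)).
    apply: (ray_linked rG rX) => //; apply: leq_trans le (leq_maxl _ _).
  move=> nv; exists n => m nm; apply: linked_trans nv.
  by apply: (ray_linked rG rX) => //; apply: leq_trans le nm.
by split=> //; rewrite E; apply: cmp_refl; [exact: ray_verts|exact: rX].
Qed.

Lemma reach_sub X Y r : X `<=` Y -> reach Y r `<=` reach X r.
Proof.
move=> XY v [N h]; exists N => m /h; exact: linked_del_sub.
Qed.

Lemma reach_cmp X r v : is_ray G r -> finite_set X -> reach X r v ->
  reach X r = cmp X v.
Proof. by move=> rG fX; have [N /(_ N (leqnn N))[-> _]] := reachE rG fX; exact: cmp_eq. Qed.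

Lemma reach_tail X r v N : is_ray G r -> finite_set X ->
  (exists2 m, N <= m & linked (del G X) (r m) v) ->
  (forall m, N <= m -> ~ X (r m)) -> reach X r v.
Proof.
move=> rG fX [m le l] nX; exists N => k lek; apply: linked_trans l.
exact: (ray_linked rG nX).
Qed.

(** For a ray [r]: its end lies in the closure of [U], which is [end_boundary] phrased for rays and
    vertex sets. *)
Definition in_cl r U : Prop :=
  forall X, finite_set X -> exists2 v, reach X r v & U v.

Definition dispersed U : Prop := forall r, is_ray G r -> ~ in_cl r U.

Lemma in_clS r U U' : U `<=` U' -> in_cl r U -> in_cl r U'.
Proof. by move=> UU h X /h[v rv /UU]; exists v. Qed.

Lemma not_in_cl r U : ~ in_cl r U ->
  exists2 X, finite_set X & forall v, reach X r v -> ~ U v.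
Proof.
move=> h; apply: contrapT => h'; apply: h => X fX; apply: contrapT => nv.
by apply: h'; exists X => // v rv Uv; apply: nv; exists v.
Qed.

(* By Jung's theorem these are the sets [A] whose ends lie in the closure of
   a normally spanned vertex set. *)
Definition good A : Prop := exists U : nat -> set V,
  (forall n, dispersed (U n)) /\
  (forall r, is_ray G r -> tail_in r A -> in_cl r (\bigcup_n U n)).

Lemma goodS A B : A `<=` B -> good B -> good A.
Proof.
move=> AB [U [dU cU]]; exists U; split=> // r rG [N h]; apply: cU => //.
by exists N => m /h /AB.
Qed.

(** A vertex enters level [n] of the new witness if it is in level [n] of the witness of its own
    component of [G - F]. Each ray has a tail in just one such component, whose witness then yields
    dispersedness and closure. *)
Lemma good_glue F A : finite_set F ->
  (forall y, A y -> verts G y -> ~ F y -> good (cmp F y)) -> good A.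
Proof.
move=> fF gA.
have [f fP] : {f : set V -> nat -> set V & forall D,
    (forall n, dispersed (f D n)) /\ (good D -> forall r, is_ray G r ->
      tail_in r D -> in_cl r (\bigcup_n f D n))}.
  apply: (@choice _ _ (fun D U => (forall n, dispersed (U n)) /\
    (good D -> forall r, is_ray G r -> tail_in r D -> in_cl r (\bigcup_n U n)))) => D.
  have [[U [dU cU]]|nD] := pselect (good D); first by exists U.
  (* Sets that are not good get empty levels, so all levels stay dispersed. *)
  exists (fun=> set0); split=> // n r rG /(_ set0 (@finite_set0 _))[] //.
exists (fun n => [set v | f (cmp F v) n v]); split.
  move=> n r rG h; have [N /(_ N (leqnn N))[E rN]] := reachE rG fF.
  have [+ _] := fP (reach F r) => /(_ n r rG); apply=> X fX.
  have [|v rv /= fv] := h (X `|` F); first by rewrite finite_setU.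
  exists v; first by apply: reach_sub rv => w; left.
  suff -> : reach F r = cmp F v by [].
  by apply: reach_cmp => //; apply: reach_sub rv => w; right.
move=> r rG [M tA]; have [N hN] := reachE rG fF.
have [E _] := hN (maxn N M) (leq_maxl _ _).
have gD : good (reach F r).
  rewrite E; have [_ rm] := hN (maxn N M) (leq_maxl _ _); rewrite E in rm.
  have [? ?] := cmp_end rm.
  by apply: gA => //; apply: tA; exact: leq_maxr.
have [_ /(_ gD r rG) h X fX] := fP (reach F r).
have {}h : in_cl r (\bigcup_n f (reach F r) n).
  by apply: h; exists N => m /hN[].
have [|v rv [n _ fv]] := h (X `|` F); first by rewrite finite_setU.
exists v; first by apply: reach_sub rv => w; left.
exists n => //=; suff <- : reach F r = cmp F v by [].
by apply: reach_cmp => //; apply: reach_sub rv => w; right.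
Qed.

Lemma bad_split F F' x : finite_set F' -> ~ good (cmp F x) ->
  exists y, [/\ cmp F x y, verts G y, ~ F' y & ~ good (cmp F' y)].
Proof.
move=> fF' bad; apply: contrapT => h; apply: bad; apply: (good_glue fF').
by move=> y xy Gy Fy; apply: contrapT => b; apply: h; exists y.
Qed.

(** Without such an edge the component of [y] would be closed under adjacency in [G - F] and so
    contain [x], which lies in [P]. *)
Lemma cmp_adjacent F P x y : P x -> cmp F x y -> cmp (F `|` P) y y ->
  exists a b, [/\ P a, cmp (F `|` P) y b & edge G a b].
Proof.
move=> Px xy yy; apply: contrapT => h.
have : cmp (F `|` P) y x.
  apply: (@linked_ind _ _ _ _ (cmp (F `|` P) y) (linked_sym xy)) => // a b ya.
  move=> [e Fa Fb]; apply: linked_edge (ya) _.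
  have [_ nFP] := cmp_end ya.
  split=> // -[//|Pb]; apply: h; exists b, a; split=> //; exact: edge_sym.
by move=> /cmp_end[_]; apply; right.
Qed.

(** * Rays through disjoint connected sets *)

Section BlobRay.
Variable P : nat -> set V.
Hypothesis Pdisj : forall n m v, P n v -> P m v -> n = m.
Hypothesis Pconn : forall n u v, P n u -> P n v -> linked (del G (~` P n)) u v.
Hypothesis Padj : forall n, exists a b, [/\ P n a, P n.+1 b & edge G a b].

(** Within [P n] the ray follows a shortest walk to a vertex with a neighbour in [P n.+1], then
    crosses over. By disjointness a finite set meets only finitely many [P n]; the later ones,
    connected and consecutively adjacent, lie in one component with a tail of the ray. *)
Lemma blob_ray : exists2 r, is_ray G r & forall X, finite_set X ->
  exists N, forall n, N <= n -> P n `<=` reach X r.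
Proof.
pose S n := [set v | exists2 w, P n.+1 w & edge G v w].
have [d dP] : {d : nat * V -> nat & forall s, P s.1 s.2 ->
    steps_to G (P s.1) (S s.1) (d s) s.2 /\
    forall j, steps_to G (P s.1) (S s.1) j s.2 -> d s <= j}.
  apply: (@choice _ _ (fun s d => P s.1 s.2 -> steps_to G (P s.1) (S s.1) d s.2 /\
    forall j, steps_to G (P s.1) (S s.1) j s.2 -> d <= j)) => -[n v] /=.
  have [Pv|] := pselect (P n v); last by exists 0.
  have [a [b [Pa Pb e]]] := Padj n.
  have [|k hk] := @steps_to_min _ G (P n) (S n) v; last by exists k.
  by apply: linked_steps_to (Pconn Pv Pa) _; exists b.
have [f fP] : {f : nat * V -> nat * V & forall s, P s.1 s.2 ->
    [/\ P (f s).1 (f s).2, edge G s.2 (f s).2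
      & s.1 < (f s).1 \/ s.1 = (f s).1 /\ d (f s) < d s]}.
  apply: (@choice _ _ (fun s t => P s.1 s.2 -> [/\ P t.1 t.2, edge G s.2 t.2
      & s.1 < t.1 \/ s.1 = t.1 /\ d t < d s])) => -[n v] /=.
  have [Pv|] := pselect (P n v); last by exists (n, v).
  have [] := dP (n, v) Pv; case: (d (n, v)) => [|k] /=.
    by move=> [w Pw e] _; exists (n.+1, w) => _; split=> //=; left.
  move=> [w [Pw e nw]] _; exists (n, w) => _; split=> //=; right; split=> //.
  by have [_] := dP (n, w) Pw; rewrite ltnS; apply.
have [a0 [_ [Pa0 _ _]]] := Padj 0.
pose s i := iter i f (0, a0).
have Ps i : P (s i).1 (s i).2 by elim: i => //= i /fP[].
(* Each move raises the index, or keeps it and lowers the distance to the exit; so no state and, by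
   disjointness, no vertex recurs. *)
have lex i k : (s i).1 < (s (i + k.+1)).1 \/
    (s i).1 = (s (i + k.+1)).1 /\ d (s (i + k.+1)) < d (s i).
  elim: k => [|k IH]; first by rewrite addn1; have [] := fP _ (Ps i).
  rewrite addnS; have [_ _] := fP _ (Ps (i + k.+1)).
  rewrite -[f _]/(s (i + k.+1).+1).
  case: IH => [lt|[-> lt]] [lt'|[<- lt']]; try by left.
  - by left; exact: ltn_trans lt lt'.
  - by right; split=> //; exact: ltn_trans lt' lt.
pose r i := (s i).2.
have sinj i k : r i <> r (i + k.+1).
  move=> E; have := lex i k.
  have E1 : (s i).1 = (s (i + k.+1)).1.
    by apply: (Pdisj (Ps i)); rewrite -/(r i) E; exact: Ps.
  have -> : s (i + k.+1) = s i.
    by rewrite [LHS]surjective_pairing [RHS]surjective_pairing -E1; congr pair.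
  by rewrite !ltnn => -[|[]].
have rI : injective r.
  move=> i j E; case: (ltngtP i j) => // lt.
    by case: (@sinj i (j - i.+1)); rewrite addnS -addSn subnKC.
  by case: (@sinj j (i - j.+1)); rewrite addnS -addSn subnKC.
have rG : is_ray G r by split=> // n; have [] := fP _ (Ps n).
have mono i j : i <= j -> (s i).1 <= (s j).1.
  move=> /subnKC <-; case: (j - i) => [|k]; first by rewrite addn0.
  by have [/ltnW|[->]] := lex i k.
have grow1 k i : d (s i) <= k -> exists j, (s i).1 < (s j).1.
  elim: k i => [|k IH] i le; have := lex i 0.
    case=> [|[_]]; first by exists (i + 1).
    by rewrite ltnNge (leq_trans le).
  case=> [|[-> lt]]; first by exists (i + 1).
  by apply: IH; rewrite -ltnS (leq_trans lt).
have grow N : exists i, N <= (s i).1.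
  elim: N => [|N [i le]]; first by exists 0.
  have [j lt] := @grow1 _ i (leqnn _); exists j; exact: leq_ltn_trans lt.
exists r => // X fX.
have [|N hN] := @finite_eventually _ X (fun x n => ~ P n x) fX.
  move=> x _; have [[n Pn]|nP] := pselect (exists n, P n x).
    by exists n.+1 => m lt Pm; move: lt; rewrite (Pdisj Pn Pm) ltnn.
  by exists 0 => m _ Pm; apply: nP; exists m.
exists N => n le v Pv.
have inX m u w : N <= m -> P m u -> P m w -> linked (del G X) u w.
  move=> le' Pu Pw; apply: linked_del_sub (Pconn Pu Pw) => x Xx Px.
  exact: hN _ le' _ Xx Px.
have chain k u w : P N u -> P (N + k) w -> linked (del G X) u w.
  elim: k u w => [|k IH] u w Pu; first by rewrite addn0; exact: inX.
  rewrite addnS => Pw; have [a [b [Pa Pb e]]] := Padj (N + k).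
  apply: linked_trans (IH _ _ Pu Pa) _.
  apply: linked_trans (edge_linked _) (inX _ _ _ _ Pb Pw).
    by split=> // Xx; [apply: (hN (N + k)) Xx Pa|apply: (hN (N + k).+1) Xx Pb];
      rewrite // -?addnS leq_addr.
  by rewrite -addnS leq_addr.
have [i lei] := grow N; exists i => m /mono lem.
have [a [_ [Pa _ _]]] := Padj N.
apply: (@linked_trans _ _ _ a).
  apply/linked_sym/(@chain ((s m).1 - N)) => //.
  by rewrite subnKC ?(leq_trans lei) //; exact: Ps.
by apply: (@chain (n - N)) => //; rewrite subnKC.
Qed.

End BlobRay.

(** * All components are good *)

Hypothesis locally_good :
  forall r, is_ray G r -> exists2 X, finite_set X & good (reach X r).

(** Stage [n] deletes a finite connected [P] containing [x n] and the part of [Y n (F n) (x n)] in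
    the current bad component, then enters a bad component of the rest next to [P]. The sets [P]
    carry a ray, and [locally_good] at this ray supplies [X]. As [Y] is a parameter, the two later
    arguments can prescribe different deletions. *)
Lemma bad_chain (Y : nat -> set V -> V -> set V) F0 x0 :
  (forall n F x, finite_set (Y n F x)) ->
  finite_set F0 -> verts G x0 -> ~ F0 x0 -> ~ good (cmp F0 x0) ->
  exists (F : nat -> set V) (x : nat -> V),
  [/\ F 0 = F0 /\ x 0 = x0,
      forall n, [/\ finite_set (F n), cmp (F n) (x n) (x n)
                  & ~ good (cmp (F n) (x n))],
      forall n, F n `<=` F n.+1
        /\ cmp (F n.+1) (x n.+1) `<=` cmp (F n) (x n),
      forall n, Y n (F n) (x n) `&` cmp (F n) (x n) `<=` F n.+1
    & exists2 X, finite_set X & exists N, forall n, N <= n ->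
        good (cmp (F n `|` X) (x n)) /\
        Y n (F n) (x n) `&` cmp (F n) (x n) `<=` cmp (F n `|` X) (x n)].
Proof.
move=> fY fF0 Gx0 Fx0 bad0.
pose bad (s : set V * V) :=
  [/\ finite_set s.1, cmp s.1 s.2 s.2 & ~ good (cmp s.1 s.2)].
pose step n (s : set V * V) (t : (set V * V) * set V) :=
  [/\ bad t.1, t.1.1 = s.1 `|` t.2, cmp t.1.1 t.1.2 `<=` cmp s.1 s.2
    & [/\ t.2 `<=` cmp s.1 s.2, t.2 s.2,
          Y n s.1 s.2 `&` cmp s.1 s.2 `<=` t.2,
          forall u v, t.2 u -> t.2 v -> linked (del G (~` t.2)) u v
        & exists2 a, t.2 a & edge G a t.1.2]].
have [f fP] : {f : nat * (set V * V) -> (set V * V) * set V &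
    forall ns, bad ns.2 -> step ns.1 ns.2 (f ns)}.
  apply: (@choice _ _ (fun ns t => bad ns.2 -> step ns.1 ns.2 t)).
  move=> [n [F x]].
  have [[/= fF xx b]|nb] := pselect (bad (F, x)); last by exists ((F, x), F) => ?.
  have [P [fP PL Px YP Pc]] := cmp_finite_conn (fY n F x) xx.
  have fFP : finite_set (F `|` P) by rewrite finite_setU.
  have [y [xy Gy Fy by_]] := bad_split fFP b.
  have yy : cmp (F `|` P) y y by exact: cmp_refl.
  (* [y] is traded for a vertex of its component adjacent to [P], so that the next connected set
     will be adjacent to this one. *)
  have [a [z [Pa yz e]]] := cmp_adjacent Px xy yy.
  exists ((F `|` P, z), P) => _; rewrite /step /bad /= -(cmp_eq yz); split=> //.
  - by apply: cmp_sub xy => w; left.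
  - by split=> //; exists a.
pose s := fix s n := if n is m.+1 then (f (m, s m)).1 else (F0, x0).
pose P n := (f (n, s n)).2.
have bs n : bad (s n).
  elim: n => [|n /(fP (n, s n))[]] //.
  by split=> //; exact: cmp_refl.
have st n : step n (s n) (s n.+1, P n).
  by have := fP (n, s n) (bs n); rewrite [f _]surjective_pairing.
have Fmono n k : (s n).1 `<=` (s (n + k)).1.
  elim: k => [|k IH]; first by rewrite addn0.
  apply: (subset_trans IH); rewrite addnS; have [_ /= -> _ _] := st (n + k).
  by move=> w; left.
have Pdisj' n k v : P n v -> ~ P (n + k.+1) v.
  move=> Pv Pv'; have [_ _ _ [PL _ _ _ _]] := st (n + k.+1).
  have [_ h] := cmp_end (PL _ Pv'); apply: h; rewrite -addSnnS; apply: Fmono.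
  by have [_ /= -> _ _] := st n; right.
have [|||r rG rP] := @blob_ray P.
- move=> n m v Pn Pm; case: (ltngtP n m) => // lt; exfalso.
    by apply: (@Pdisj' n (m - n.+1) v) => //; rewrite addnS -addSn subnKC.
  by apply: (@Pdisj' m (n - m.+1) v) => //; rewrite addnS -addSn subnKC.
- by move=> n u v; have [_ _ _ [_ _ _ h _]] := st n; exact: h.
- move=> n; have [_ _ _ [_ _ _ _ [a Pa e]]] := st n; exists a, (s n.+1).2; split=> //.
  by have [_ _ _ [_ ? _ _ _]] := st n.+1.
exists (fun n => (s n).1), (fun n => (s n).2); split=> //.
- move=> n; have [_ /= E sub _] := st n; split=> //.
  by rewrite E => w; left.
- move=> n w Yw; have [_ /= -> _ [_ _ h _ _]] := st n; right; exact: h.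
have [X fX gX] := locally_good rG; exists X => //.
have [N hN] := rP X fX; exists N => n /hN Pr.
have [_ _ _ [PL Px YP Pc _]] := st n.
(* [reach X r] is the component of [G - X] at the base point. As [P n] is connected and avoids [F n]
   and [X], it links the base point to the required part of [Y]. *)
have E := reach_cmp rG fX (Pr _ Px).
split.
  apply: goodS gX; rewrite E.
  apply: cmp_sub; first by move=> w; right.
  by rewrite -E; exact: Pr Px.
move=> y /YP Py; apply: linked_del_sub (Pc _ _ Px Py) => w [Fw|Xw] Pw.
  by have [_] := cmp_end (PL _ Pw).
by have := Pr _ Pw; rewrite E => /cmp_end[].
Qed.

(** Otherwise choose finite [Z n] in turn such that the component [K n] at [x] left by deleting
    [Z n] is good and absorbs the preceding [Z]. The [K n] exhaust the bad component, while a bad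
    chain deleting [Z n] at stage [n] escapes them all; so it eventually misses the set [X] of
    [bad_chain], and becomes good. *)
Lemma bad_unabsorbed F x : finite_set F -> verts G x -> ~ F x ->
  ~ good (cmp F x) -> exists2 Y, finite_set Y & forall Z, finite_set Z ->
    good (cmp (F `|` Z) x) -> ~ (Y `&` cmp F x `<=` cmp (F `|` Z) x).
Proof.
move=> fF Gx Fx bad; apply: contrapT => h.
have [z zP] : {z : set V -> set V & forall Y, finite_set Y ->
    [/\ finite_set (z Y), good (cmp (F `|` z Y) x)
      & Y `&` cmp F x `<=` cmp (F `|` z Y) x]}.
  apply: (@choice _ _ (fun Y Z => finite_set Y -> [/\ finite_set Z,
    good (cmp (F `|` Z) x) & Y `&` cmp F x `<=` cmp (F `|` Z) x])) => Y.
  have [fY|] := pselect (finite_set Y); last by exists set0.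
  apply: contrapT => h'; apply: h; exists Y => // Z fZ gZ YZ.
  by apply: h'; exists Z.
pose Z n := iter n z (z [set x]).
have fZ n : finite_set (Z n).
  by elim: n => [|n IH] /=; [have [] := zP _ (finite_set1 x)|have [] := zP _ IH].
pose K n := cmp (F `|` Z n) x.
have gK n : good (K n).
  case: n => [|n]; first by have [] := zP _ (finite_set1 x).
  by have [] := zP _ (fZ n).
(* A neighbour of [K n] in the component is in [K n] or in [Z n], hence in [K n] or [K n.+1]. *)
have LK v : cmp F x v -> exists n, K n v.
  move=> xv; suff [] : cmp F x v /\ exists n, K n v by [].
  apply: (@linked_ind _ _ _ _ [set v | cmp F x v /\ exists n, K n v] xv).
    split; first exact: cmp_refl.
    by exists 0; have [_ _] := zP _ (finite_set1 x); apply; split=> //; exact: cmp_refl.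
  move=> a b [xa [n Ka]] ab; have xb : cmp F x b := linked_edge xa ab.
  split=> //; have [Zb|Zb] := pselect (Z n b).
    by exists n.+1; have [_ _] := zP _ (fZ n); apply.
  exists n; apply: linked_edge (Ka) _; have [e Fa Fb] := ab.
  by have [_ ?] := cmp_end Ka; split=> // -[].
have [Fs [xs [[E0 E0'] bs mono YF [X fX [N hN]]]]] :=
  bad_chain (fun n _ _ => fZ n) fF Gx Fx bad.
pose L n := cmp (Fs n) (xs n).
have Lmono n k : L (n + k) `<=` L n.
  elim: k => [|k IH]; first by rewrite addn0.
  by apply: subset_trans IH; rewrite addnS; have [_] := mono (n + k).
have Fmono n : F `<=` Fs n.
  rewrite -E0; elim: n => // n IH; apply: (subset_trans IH).
  by have [] := mono n.
(* Stage [n] deletes the boundary [Z n] of [K n], so if the next region met [K n] it would lie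
   inside it and be good. *)
have LK' n v : L n.+1 v -> ~ K n v.
  move=> Lv Kv; have [_ _] := bs n.+1; apply; apply: goodS (gK n).
  rewrite -/(L n.+1) /L (cmp_eq Lv) /K (cmp_eq Kv).
  apply: (subset_trans (@cmp_avoid _ (Z n) _ _)).
    move=> w; rewrite -(cmp_eq Lv) => Lw Zw.
    have [_] := cmp_end Lw; apply; apply: YF; split=> //.
    by have [_] := mono n; apply.
  apply: cmp_sub; first by move=> w [/Fmono|]; [left|right].
  by have [? ?] := cmp_end Lv; have [_ nFZ] := cmp_end Kv;
    apply: cmp_refl.
have [|M hM] := @finite_eventually _ X (fun v n => ~ L n v) fX.
  move=> v _; have [/LK[n Kv]|nv] := pselect (cmp F x v).
    exists n.+1 => m /subnKC <- /Lmono Lv; exact: LK' Lv Kv.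
  by exists 0 => m _ /(Lmono 0); rewrite /L E0 E0'.
have [gX _] := hN (maxn N M) (leq_maxl _ _).
have [_ _] := bs (maxn N M); apply; apply: goodS gX.
by apply: cmp_avoid => v Lv Xv; apply: (hM _ (leq_maxr N M) v Xv).
Qed.

(** Run the chain with the sets from [bad_unabsorbed]: the [X] returned by [bad_chain] absorbs one
    of them into a good component, which is excluded. *)
Lemma region_good F x : finite_set F -> verts G x -> ~ F x -> good (cmp F x).
Proof.
move=> fF Gx Fx; apply: contrapT => bad.
have [y yP] : {y : set V * V -> set V & forall s, finite_set (y s) /\
    (finite_set s.1 -> cmp s.1 s.2 s.2 -> ~ good (cmp s.1 s.2) ->
     forall Z, finite_set Z -> good (cmp (s.1 `|` Z) s.2) ->
       ~ (y s `&` cmp s.1 s.2 `<=` cmp (s.1 `|` Z) s.2))}.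
  apply: (@choice _ _ (fun s y => finite_set y /\
    (finite_set s.1 -> cmp s.1 s.2 s.2 -> ~ good (cmp s.1 s.2) ->
     forall Z, finite_set Z -> good (cmp (s.1 `|` Z) s.2) ->
       ~ (y `&` cmp s.1 s.2 `<=` cmp (s.1 `|` Z) s.2)))) => -[F' x'] /=.
  have [[fF' xx b]|nb] := pselect [/\ finite_set F', cmp F' x' x'
      & ~ good (cmp F' x')].
    have [Gx' Fx'] := cmp_end xx.
    by have [Y fY hY] := bad_unabsorbed fF' Gx' Fx' b; exists Y; split.
  by exists set0; split=> // *; case: nb.
have [Fs [xs [_ bs _ _ [X fX [N /(_ N (leqnn N))[gX hX]]]]]] :=
  @bad_chain (fun _ F x => y (F, x)) F x (fun _ F x => (yP (F, x)).1) fF Gx Fx bad.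
by have [fN xN bN] := bs N; apply: (yP (Fs N, xs N)).2 hX.
Qed.

End Components.

(** * Normal trees *)
Section Trees.
Variables (V : Type) (T : graph V).
Implicit Types (p q : nat -> V).

Lemma path_prefix p n k : is_path T p n -> k <= n -> is_path T p k.
Proof.
move=> [p0 pe pI] le; split=> // [i lt|i j li lj].
  by apply: pe; exact: leq_trans le.
by apply: pI; [exact: leq_trans le|exact: leq_trans le].
Qed.

Lemma path_rcons p n s : is_path T p n -> edge T (p n) s ->
  (forall i, i <= n -> p i <> s) ->
  is_path T (fun i => if i <= n then p i else s) n.+1.
Proof.
move=> [p0 pe pI] e ns; split=> // [i|i j].
  rewrite ltnS => le; rewrite le; case: ltnP => [/pe //|ge].
  by rewrite (@anti_leq i n) // le.
rewrite (leq_eqVlt i) (leq_eqVlt j) !ltnS.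
move=> /predU1P[->|li] /predU1P[->|lj] //; rewrite ?ltnn ?li ?lj.
- by move=> /esym/ns; move=> /(_ lj).
- by move=> /ns; move=> /(_ li).
- exact: pI.
Qed.

(** A non-trivial path from [a] to [b] avoiding [s] would close to a cycle through [s]. *)
Lemma acyclic_pred_unique a b s : (forall p n, ~ is_cycle T p n) ->
  edge T a s -> edge T b s -> linked (del T [set s]) a b -> a = b.
Proof.
move=> acyc ea eb [p [n [pP p0 pn]]].
have ps i : i <= n -> p i <> s by move=> le; have [_] := path_verts pP le.
have pT := Defs.sub_path (@del_sub _ T [set s]) pP.
case: n pn pP ps pT => [|n] pn pP ps pT; first by rewrite -p0.
case: (acyc (fun i => if i <= n.+1 then p i else s) n.+2); split=> //.
  by apply: path_rcons => //; rewrite pn.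
by rewrite ltnn p0; exact: edge_sym.
Qed.

(** Induction from the common last vertex: the penultimate vertices are linked through the common
    start without it, so they agree. *)
Lemma acyclic_path_unique p n q m : (forall p n, ~ is_cycle T p n) ->
  is_path T p n -> is_path T q m -> p 0 = q 0 -> p n = q m ->
  n = m /\ forall i, i <= n -> p i = q i.
Proof.
move=> acyc; elim: n m => [|n IH] m pP qP E0 En.
  have -> : m = 0 by have [_ _ qI] := qP; apply: qI; rewrite // -En.
  by split=> // i; rewrite leqn0 => /eqP ->.
case: m qP En => [|m] qP En.
  by have [_ _ pI] := pP; have := pI n.+1 0 (leqnn _) isT; rewrite En E0 => /(_ erefl).
have tolast r k (rP : is_path T r k.+1) :
    linked (del T [set r k.+1]) (r 0) (r k).
  exists r, k; split=> //; apply: path_del; first exact: path_prefix rP _.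
  move=> i le E; have [_ _ /(_ i k.+1 (leqW le) (leqnn _) E) Ei] := rP.
  by move: le; rewrite Ei ltnn.
have Em : p n = q m.
  have [_ pe _] := pP; have [_ qe _] := qP.
  apply: (@acyclic_pred_unique _ _ (p n.+1)) => //.
  - exact: pe.
  - by rewrite En; exact: qe.
  - apply: (@linked_trans _ _ _ (p 0)); first exact/linked_sym/tolast.
    by rewrite E0 En; exact: tolast.
have [E h] := IH m (path_prefix pP (leqnSn n)) (path_prefix qP (leqnSn m)) E0 Em.
subst m; split=> // i; rewrite leq_eqVlt => /predU1P[->//|].
by rewrite ltnS; exact: h.
Qed.

Lemma sub_del_graph (G : graph V) X :
  subgraph T G -> subgraph (del T X) (del G X).
Proof.
move=> [TV TE]; split=> [a [/TV]|a b [/TE]] //.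
Qed.

End Trees.

Section NormalTree.
Variables (V : Type) (G T : graph V) (x0 : V).
Hypothesis nT : normal_tree G T x0.

(** [anc v i] is the vertex at height [i] on the tree path from the root to [v], and [ht v] the
    height of [v]; both are junk off the tree. *)
Lemma root_paths : exists (anc : V -> nat -> V) (ht : V -> nat),
  forall v, verts T v ->
    [/\ is_path T (anc v) (ht v), anc v 0 = x0 & anc v (ht v) = v].
Proof.
have [_ [[_ cT] _] Tx _] := nT.
have [f fP] : {f : V -> (nat -> V) * nat & forall v, verts T v ->
    [/\ is_path T (f v).1 (f v).2, (f v).1 0 = x0 & (f v).1 (f v).2 = v]}.
  apply: (@choice _ _ (fun v f => verts T v ->
    [/\ is_path T f.1 f.2, f.1 0 = x0 & f.1 f.2 = v])) => v.
  have [Tv|] := pselect (verts T v); last by exists (fun=> x0, 0).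
  by have [p [n h]] := cT _ _ Tx Tv; exists (p, n).
by exists (fun v => (f v).1), (fun v => (f v).2).
Qed.

Variables (anc : V -> nat -> V) (ht : V -> nat).
Hypothesis ancP : forall v, verts T v ->
  [/\ is_path T (anc v) (ht v), anc v 0 = x0 & anc v (ht v) = v].

Lemma ancE p n : is_path T p n -> p 0 = x0 ->
  n = ht (p n) /\ forall i, i <= n -> p i = anc (p n) i.
Proof.
move=> pP p0; have [_ [_ acyc] _ _] := nT.
have [aP a0 an] := ancP (path_verts pP (leqnn n)).
by apply: acyclic_path_unique; rewrite // p0.
Qed.

Lemma anc_verts v i : verts T v -> i <= ht v -> verts T (anc v i).
Proof. by move=> /ancP[aP _ _]; exact: path_verts. Qed.

Lemma ht_anc v i : verts T v -> i <= ht v ->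
  ht (anc v i) = i /\ forall j, j <= i -> anc (anc v i) j = anc v j.
Proof.
move=> /ancP[aP a0 _] le; have [Ei h] := ancE (path_prefix aP le) a0.
by split=> // j /h.
Qed.

Lemma tree_le_anc u v : tree_le T x0 u v ->
  [/\ verts T v, ht u <= ht v & anc v (ht u) = u].
Proof.
move=> [p [n [pP p0 pn [i le <-]]]].
have Tv : verts T v by rewrite -pn; exact: path_verts pP _.
have [En h] := ancE pP p0; rewrite pn in En h.
have {}h := h i le; rewrite h; have [] := @ht_anc v i Tv; rewrite -?En //.
by move=> -> _.
Qed.

Lemma anc_linked v k Z : verts T v -> k <= ht v ->
  (forall x, Z x -> verts T x -> ht x < k) -> linked (del T Z) (anc v k) v.
Proof.
move=> Tv le hZ; have [aP _ an] := ancP Tv.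
have nZ j : k <= j -> j <= ht v -> ~ Z (anc v j).
  move=> kj jh Zj; have := hZ _ Zj (anc_verts Tv jh).
  by have [-> _] := ht_anc Tv jh; rewrite ltnNge kj.
suff h j : k + j <= ht v -> linked (del T Z) (anc v k) (anc v (k + j)).
  by have := h (ht v - k); rewrite subnKC // an; exact.
elim: j => [|j IH] lj.
  by rewrite addn0; apply: linked_refl; split; [exact: anc_verts|exact: nZ].
rewrite addnS in lj *; apply: linked_edge (IH (ltnW lj)) _.
have [_ ae _] := aP; split; first exact: ae.
  by apply: nZ; rewrite ?leq_addr // ltnW.
by apply: nZ; rewrite // -addnS leq_addr.
Qed.

(* Consecutive vertices of [T] on a path that stays above level [k] are
   comparable, hence have the same ancestor at level [k]. *)
Lemma linked_same_anc Z k t s : verts T t -> verts T s ->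
  (forall u, verts T u -> ht u < k -> Z u) ->
  linked (del G Z) t s -> anc t k = anc s k.
Proof.
move=> Tt Ts hZ [p [n [pP p0 pn]]]; have [_ _ _ nrm] := nT.
have hk i : i <= n -> verts T (p i) -> k <= ht (p i).
  move=> le Tp; rewrite leqNgt; apply/negP => /(hZ _ Tp).
  by have [_] := path_verts pP le.
have comp u v : tree_le T x0 u v -> k <= ht u -> anc v k = anc u k.
  move=> /tree_le_anc[Tv le <-] lk; have [E h] := ht_anc Tv le.
  by rewrite h // -E.
suff h i : i <= n -> exists j, [/\ j <= i, verts T (p j), anc (p j) k = anc t k
    & forall l, j < l -> l <= i -> ~ verts T (p l)].
  have [j [le Tj Ej hj]] := h n (leqnn n).
  rewrite -Ej -pn; move: le; rewrite leq_eqVlt => /predU1P[->//|lt].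
  by case: (hj n lt); rewrite ?pn.
elim: i => [_|i IH lt].
  by exists 0; rewrite p0; split=> // l; case: l.
have [j [le Tj Ej hj]] := IH (ltnW lt).
have [Ti|nTi] := pselect (verts T (p i.+1)); last first.
  exists j; split=> //; first exact: leqW.
  by move=> l jl; rewrite leq_eqVlt => /predU1P[->//|]; rewrite ltnS; exact: hj.
exists i.+1; split=> //; last by move=> l l1 l2; have := leq_trans l1 l2; rewrite ltnn.
pose q l := p (j + l).
have jk : j + (i.+1 - j) = i.+1 by rewrite subnKC // leqW.
have ln l : l <= i.+1 - j -> j + l <= n.
  by move=> ll; apply: leq_trans lt; rewrite -jk leq_add2l.
have : is_Hpath G T q (i.+1 - j).
  split.
  - have [_ pe pI] := pP; split=> /=.
    + rewrite /q addn0; have [TG _ _ _] := nT; exact: TG.1.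
    + move=> l ll; rewrite /q addnS; have [] // := pe (j + l).
      by rewrite -addnS; exact: ln.
    + move=> a b la lb E; apply/eqP; rewrite -(eqn_add2l j); apply/eqP.
      by apply: pI E; exact: ln.
  - by rewrite subn_gt0.
  move=> l ll; split=> [Tl|[->|->]]; rewrite /q ?addn0 ?jk //.
  case: l ll Tl => [|l] ll Tl; first by left.
  right; apply: contrapT => ne; apply: (hj (j + l.+1)) => //.
    by rewrite addnS ltnS leq_addr.
  rewrite -ltnS -[X in _ < X]jk ltn_add2l ltn_neqAle ll andbT.
  exact/eqP.
move=> /nrm; rewrite /q addn0 jk => -[] /comp h.
  by rewrite h ?Ej // hk // (leq_trans le) // ltnW.
by rewrite -Ej h // hk.
Qed.

Definition level n : set V := [set u | verts T u /\ ht u < n].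

Lemma reach_same_anc X r n t s : is_ray G r -> finite_set X ->
  (forall v, reach G X r v -> ~ level n v) ->
  reach G X r t -> reach G X r s -> verts T t -> verts T s ->
  [/\ n <= ht t, n <= ht s & anc t n = anc s n].
Proof.
move=> rG fX hX rt rs Tt Ts.
have up u : reach G X r u -> verts T u -> n <= ht u.
  by move=> ru Tu; rewrite leqNgt; apply/negP => lt; apply: hX ru _.
split; [exact: up|exact: up|].
apply: (@linked_same_anc (X `|` level n)) => //; first by move=> u; right.
have E := reach_cmp rG fX rt; rewrite E in rs hX.
exact: (cmp_avoid hX rs).
Qed.

(** If [X] cuts the ray off from all heights below [n], then the tree vertices beyond [X] share
    their ancestor at height [n]. So at most one of them has height [n], and deleting it cuts off
    the next level. *)
Lemma level_dispersed n : dispersed G (level n).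
Proof.
elim: n => [|n IH] r rG cl.
  by have [v _ []] := cl set0 (@finite_set0 _).
have [X fX hX] := not_in_cl (IH r rG).
have [t rt [Tt htt]] := cl X fX.
have [|s rs [Ts hts]] := cl (X `|` [set t]).
  by rewrite finite_setU; split=> //; exact: finite_set1.
have rs' : reach G X r s by apply: reach_sub rs => w; left.
have [lt ls E] := reach_same_anc rG fX hX rt rs' Tt Ts.
have Et : ht t = n by apply/eqP; rewrite eqn_leq lt -ltnS htt.
have Es : ht s = n by apply/eqP; rewrite eqn_leq ls -ltnS hts.
have [M hM] := rs; have [_ [_]] := linked_verts (hM M (leqnn M)).
apply; right => /=; have [_ _ <-] := ancP Tt; have [_ _ <-] := ancP Ts.
by rewrite Et Es.
Qed.

Lemma finite_height X : finite_set X ->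
  exists n, forall x, X x -> verts T x -> ht x < n.
Proof.
move=> fX; have [|n h] := @finite_eventually _ X (fun x n => verts T x -> ht x < n) fX.
  by move=> x _; exists (ht x).+1 => m.
by exists n => x; apply: h.
Qed.

(** Beyond a finite set cutting off all heights below [n], the tree vertices share an ancestor [s n]
    at height [n]; these ancestors form the ray. It is equivalent to [r], since tree paths starting
    high enough avoid any given finite set. *)
Lemma tree_ray_of_closure r : is_ray G r -> in_cl G r (verts T) ->
  exists2 s, is_ray T s & ray_equiv G r s.
Proof.
move=> rG cl; have [TG _ _ _] := nT.
have [X XP] : {X : nat -> set V & forall n, finite_set (X n)
    /\ forall v, reach G (X n) r v -> ~ level n v}.
  apply: (@choice _ _ (fun n X => finite_set X
    /\ forall v, reach G X r v -> ~ level n v)) => n.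
  by have [X fX hX] := not_in_cl (@level_dispersed n r rG); exists X.
have fX n := (XP n).1.
have [t tP] : {t : nat -> V & forall n, reach G (X n) r (t n) /\ verts T (t n)}.
  apply: (@choice _ _ (fun n t => reach G (X n) r t /\ verts T t)) => n.
  by have [v rv Tv] := cl _ (fX n); exists v.
pose s n := anc (t n) n.
have sP n v : reach G (X n) r v -> verts T v -> n <= ht v /\ s n = anc v n.
  move=> rv Tv; have [rt Tt] := tP n.
  by have [_ le E] := reach_same_anc rG (fX n) (XP n).2 rt rv Tt Tv.
have sht n : ht (s n) = n.
  have [rt Tt] := tP n; have [le _] := sP n _ rt Tt.
  by have [] := ht_anc Tt le.
have sT : is_ray T s.
  split=> [a b E|n]; first by rewrite -(sht a) -(sht b) E.
  (* A tree vertex beyond both cuts has [s n] and [s n.+1] as consecutive ancestors. *)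
  have [|v rv Tv] := cl (X n `|` X n.+1); first by rewrite finite_setU; split.
  have [|_ ->] := sP n v _ Tv; first by apply: reach_sub rv => w; left.
  have [|le ->] := sP n.+1 v _ Tv; first by apply: reach_sub rv => w; right.
  by have [[_ ae _] _ _] := ancP Tv; exact: ae.
exists s => //; apply: linked_ray_equiv => Y fY _.
have [n hn] := finite_height fY.
have [|v rv Tv] := cl (Y `|` X n); first by rewrite finite_setU; split.
have [|le E] := sP n v _ Tv; first by apply: reach_sub rv => w; right.
have [m hm] := rv; have l := hm m (leqnn m); exists m, n; rewrite E.
apply: (@linked_trans _ _ _ v); first by apply: linked_del_sub l => w; left.
apply/linked_sym/(sub_linked (sub_del_graph _ TG)).
by apply: anc_linked => // x Yx Tx; exact: hn.
Qed.

(** Far out, vertices of the two rays share an ancestor higher than all tree vertices of the finite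
    set, and are linked in [T] through it. *)
Lemma tree_rays_equiv r s : is_ray T r -> is_ray T s ->
  ray_equiv G r s -> ray_equiv T r s.
Proof.
move=> rT sT rs; have [TG _ _ _] := nT.
have rG := sub_ray TG rT; have sG := sub_ray TG sT.
apply: linked_ray_equiv => Y fY _; have [n hn] := finite_height fY.
have [X fX hX] := not_in_cl (@level_dispersed n r rG).
have fXG : finite_set (X `&` verts G) by apply: sub_finite_set fX => w [].
have [|N hN] := ray_equiv_linked rG sG rs fXG; first by move=> w [].
have [M hM] := reachE rG fX; pose m := maxn N M.
have [E rm] := hM m (leq_maxr _ _).
have rsm : reach G X r (s m).
  by rewrite E; apply/linked_delI/hN; exact: leq_maxl.
have Tr := ray_verts m rT; have Ts := ray_verts m sT.
have [lr ls Ea] := reach_same_anc rG fX hX rm rsm Tr Ts.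
exists m, m; apply: (@linked_trans _ _ _ (anc (r m) n)).
  by apply/linked_sym/anc_linked => // x Yx Tx; exact: hn.
by rewrite Ea; apply: anc_linked => // x Yx Tx; exact: hn.
Qed.

End NormalTree.

Lemma normal_tree_levels (V : Type) (G T : graph V) x0 : normal_tree G T x0 ->
  exists2 U : nat -> set V, (forall n, dispersed G (U n))
    & verts T `<=` \bigcup_n U n.
Proof.
move=> nT; have [anc [ht ancP]] := root_paths nT.
exists (level T ht); first exact: level_dispersed nT _ _ ancP.
by move=> v Tv; exists (ht v).+1.
Qed.

Lemma ends_end_of (V : Type) (G : graph V) (w : ends G) :
  exists r (rG : is_ray G r), w = end_of rG.
Proof.
by have [r rG E] := rays_ofP w; exists r, rG; apply: eq_end.
Qed.

Lemma end_of_inj (V : Type) (G : graph V) r s (rG : is_ray G r)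
  (sG : is_ray G s) : end_of rG = end_of sG -> ray_equiv G r s.
Proof.
move=> /(congr1 (@rays_of _ _)) /= E.
have : [set t | is_ray G t /\ ray_equiv G s t] s.
  by split=> //; exact: ray_equiv_refl.
by rewrite -E => -[].
Qed.

Lemma normal_tree_end_faithful (V : Type) (G T : graph V) x0 :
  normal_tree G T x0 -> (forall r, is_ray G r -> in_cl G r (verts T)) ->
  end_faithful T G.
Proof.
move=> nT cl; have [TG _ _ _] := nT; exists TG.
have [anc [ht ancP]] := root_paths nT.
rewrite -setTT_bijective; split=> //.
- move=> w w' _ _; have [r [rT ->]] := ends_end_of w.
  have [s [sT ->]] := ends_end_of w'.
  rewrite !end_map_end_of => /end_of_inj rs; apply: end_of_equiv.
  exact: (tree_rays_equiv nT ancP).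
- move=> w _; have [r [rG ->]] := ends_end_of w.
  have [s sT rs] := tree_ray_of_closure nT ancP rG (cl r rG).
  exists (end_of sT) => //; rewrite end_map_end_of; apply: end_of_equiv.
  by apply: ray_equiv_sym rs => //; exact: sub_ray TG sT.
Qed.

(** * Depth-first search trees *)
Section DepthFirstTree.
Variables (V : Type) (G : graph V) (x0 : V) (pick : set V -> V -> V).
Hypothesis Gconn : graph_connected G.
Hypothesis Gx0 : verts G x0.
Hypothesis pickP : forall D v, (exists2 w, D w & edge G v w) ->
  D (pick D v) /\ edge G v (pick D v).

(* The depth-first search followed only in the components containing [z].
   Once [z] is visited its component is empty and the values are junk. *)
Fixpoint search (z : V) n : set V * V :=
  if n is m.+1 then
    let s := search z m in
    (s.1 `|` [set s.2], pick (cmp G (s.1 `|` [set s.2]) z) s.2)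
  else (set0, x0).

Definition visited z n := (search z n).1.
Definition current z n := (search z n).2.
(** This [n] is the height of [z] in the tree built below; a vertex never found stays outside it. *)
Definition found z n := [/\ verts G z, current z n = z & ~ visited z n z].

Lemma visitedS z n : visited z n.+1 = visited z n `|` [set current z n].
Proof. by []. Qed.

Lemma visited_mono z n m : n <= m -> visited z n `<=` visited z m.
Proof.
move=> /subnKC <-; elim: (m - n) => [|k IH]; first by rewrite addn0.
by rewrite addnS => w /IH; left.
Qed.

Lemma current_visited z n m : n < m -> visited z m (current z n).
Proof. by move=> lt; apply: (visited_mono lt); right. Qed.

Lemma visitedP z n w : visited z n w -> exists2 i, i < n & w = current z i.
Proof.
elim: n => // n IH [/IH[i lt ->]|->]; last by exists n.
by exists i => //; exact: ltnW.
Qed.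

(** The search depends on its target only through the component containing the target. *)
Lemma search_eq z w n i : cmp G (visited z n) z w -> i <= n ->
  search w i = search z i.
Proof.
move=> zw; elim: i => // i IH lt /=; rewrite IH; last exact: ltnW.
congr pair; congr pick; apply/esym/cmp_eq.
by apply: linked_del_sub zw; exact: (visited_mono lt).
Qed.

Lemma pick_next z n : verts G z -> ~ visited z n.+1 z ->
  cmp G (visited z n) z (current z n) ->
  cmp G (visited z n.+1) z (current z n.+1)
  /\ edge G (current z n) (current z n.+1).
Proof.
move=> Gz nz zc.
have [|a [b [-> zb e]]] := @cmp_adjacent _ G (visited z n) [set current z n]
  (current z n) z erefl (linked_sym zc); first exact: cmp_refl.
by apply: pickP; exists b.
Qed.

Lemma current_cmp z n : verts G z -> ~ visited z n z ->
  cmp G (visited z n) z (current z n).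
Proof.
move=> Gz; elim: n => [|n IH] nz.
  apply: sub_linked (Gconn.2 _ _ Gz Gx0).
  by split=> [a Ga|a b e]; split.
by have [] := pick_next Gz nz (IH _) => // h; apply: nz; left.
Qed.

Lemma current_edge z n : verts G z -> ~ visited z n.+1 z ->
  edge G (current z n) (current z n.+1).
Proof.
move=> Gz nz; have [] // := pick_next Gz nz (current_cmp Gz _).
by move=> h; apply: nz; left.
Qed.

Lemma current_found z n : verts G z -> ~ visited z n z ->
  found (current z n) n.
Proof.
move=> Gz nz; have zc := current_cmp Gz nz.
have E := search_eq zc (leqnn n); have [Gc nc] := cmp_end zc.
by split=> //; rewrite /current /visited E.
Qed.

Lemma current_current z n i : verts G z -> ~ visited z n z -> i <= n ->
  current (current z n) i = current z i.
Proof.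
by move=> Gz nz le; rewrite /current (search_eq (current_cmp Gz nz) le).
Qed.

Lemma found_unvisited z n i : found z n -> i <= n -> ~ visited z i z.
Proof. by move=> [_ _ nz] le /(visited_mono le). Qed.

Lemma found_inj z n m : found z n -> found z m -> n = m.
Proof.
move=> [_ En nn] [_ Em nm]; case: (ltngtP n m) => // lt.
  by case: nm; rewrite -{2}En; exact: current_visited.
by case: nn; rewrite -{2}Em; exact: current_visited.
Qed.

Definition parent u v : Prop := exists2 n, found v n.+1 & current v n = u.

Lemma parent_found u v : parent u v ->
  exists n, [/\ found u n, found v n.+1 & current v n = u].
Proof.
move=> [n fv <-]; exists n; split=> //.
by apply: current_found; [have [] := fv|exact: found_unvisited fv (leqnSn n)].
Qed.

Lemma parent_edge u v : parent u v -> edge G u v.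
Proof.
move=> [n fv <-]; have [Gv Ev nv] := fv.
by rewrite -[X in edge _ _ X]Ev; exact: current_edge.
Qed.

Definition dfs_tree : graph V.
Proof.
refine {| verts := [set z | exists n, found z n];
          edge := fun u v => parent u v \/ parent v u |}.
- by move=> u v [|]; [right|left].
- by move=> u [] h; exact: edge_irrefl (parent_edge h).
- by move=> u v [] h; have [n [? ? _]] := parent_found h; [exists n|exists n.+1].
Defined.

Lemma dfs_sub : subgraph dfs_tree G.
Proof.
by split=> [v [n []] //|u v [] h]; [|apply: edge_sym]; exact: parent_edge h.
Qed.

Lemma dfs_path z n : found z n -> is_path dfs_tree (current z) n.
Proof.
move=> fz; have [Gz Ez nz] := fz.
have al i : i <= n -> ~ visited z i z by exact: found_unvisited.
split=> [|i lt|i j li lj E].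
- by exists 0; exact: current_found Gz (al 0 (leq0n n)).
- left; exists i; first exact: current_found Gz (al i.+1 lt).
  exact: current_current Gz (al i.+1 lt) (leqnSn i).
- have fi := current_found Gz (al i li); rewrite E in fi.
  exact: found_inj fi (current_found Gz (al j lj)).
Qed.

Lemma dfs_root : found x0 0.
Proof. by split. Qed.

Lemma dfs_connected : graph_connected dfs_tree.
Proof.
split; first by exists x0, 0; exact: dfs_root.
have h z : verts dfs_tree z -> linked dfs_tree x0 z.
  by move=> [n fz]; exists (current z), n; split=> //;
    [exact: dfs_path|have [] := fz].
by move=> u v /h xu /h; apply: linked_trans; exact: linked_sym.
Qed.

(* A vertex of maximal height on a cycle would have two distinct parents. *)
Lemma dfs_acyclic p n : ~ is_cycle dfs_tree p n.
Proof.
move=> [pP le2 e0]; have [_ pe pI] := pP.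
have [h hP] : {h : nat -> nat & forall i, i <= n -> found (p i) (h i)}.
  apply: (@choice _ _ (fun i h => i <= n -> found (p i) h)) => i.
  have [le|_] := boolP (i <= n); last by exists 0.
  by have [k fk] := path_verts pP le; exists k.
pose i := [arg max_(j > ord0 : 'I_n.+1) h j].
have imax j : j <= n -> h j <= h i.
  rewrite -ltnS => lt; rewrite /i; case: arg_maxnP => // k _ /(_ (Ordinal lt)).
  by apply.
have lei : i <= n by rewrite -ltnS; exact: ltn_ord.
have up j : j <= n -> edge dfs_tree (p i) (p j) -> p j = current (p i) (h i).-1.
  move=> le [] /parent_found[k [f1 f2 E]].
    have := imax j le; rewrite (found_inj (hP _ le) f2).
    by rewrite (found_inj (hP _ lei) f1) ltnn.
  by rewrite (found_inj (hP _ lei) f2).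
have two j k : j <= n -> k <= n -> j <> k -> edge dfs_tree (p i) (p j) ->
    edge dfs_tree (p i) (p k) -> False.
  by move=> lj lk ne /up ej /up ek; apply: ne; apply: pI; rewrite // ej ?ek.
case: (nat_of_ord i) lei two => [_|m lt] two.
  apply: (two 1 n) => //; first exact: ltnW.
  - by move=> E; rewrite -E in le2.
  - by apply: pe; exact: ltnW.
  - exact: edge_sym.
have em : edge dfs_tree (p m.+1) (p m) by apply/edge_sym/pe.
move: (lt); rewrite leq_eqVlt => /predU1P[E|lt2].
  apply: (two m 0) => //; first exact: ltnW.
  - by move=> m0; rewrite -E m0 in le2.
  - by rewrite E.
apply: (two m m.+2) => //; first exact: ltnW.
- by move=> E; have := leqnSn m.+1; rewrite -E ltnn.
- exact: pe.
Qed.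

Lemma dfs_tree_le u w a b : found u a -> found w b -> a <= b ->
  cmp G (visited u a) u w -> tree_le dfs_tree x0 u w.
Proof.
move=> fu fw le uw; exists (current w), b; split=> //.
- exact: dfs_path.
- by have [] := fw.
- by exists a => //; rewrite /current (search_eq uw (leqnn a)); have [] := fu.
Qed.

Lemma visited_found z n i w : found z n -> i <= n -> visited z i w ->
  exists2 j, j < i & found w j.
Proof.
move=> fz le /visitedP[j lt ->]; exists j => //.
apply: current_found; first by have [] := fz.
by apply: found_unvisited fz _; exact: leq_trans (ltnW lt) le.
Qed.

(** Let the end of smaller height be found first. All vertices visited before it are in the tree at
    smaller height, so the path avoids them. Hence the other end is then in the same component, and
    its search passes through the first. *)
Lemma dfs_normal : normal_tree G dfs_tree x0.
Proof.
split; [exact: dfs_sub|by split; [exact: dfs_connected|exact: dfs_acyclic]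
  |by exists 0; exact: dfs_root|].
move=> p m [pP m0 pH].
have [a fu] : verts dfs_tree (p 0) by apply/pH => //; left.
have [b fw] : verts dfs_tree (p m) by apply/pH => //; right.
have avoid z n : found z n -> n <= a -> n <= b ->
    linked (del G (visited z n)) (p 0) (p m).
  move=> fz na nb; exists p, m; split=> //; apply: path_del => // i le.
  move=> /(visited_found fz (leqnn n))[j lt fj].
  have /pH : verts dfs_tree (p i) by exists j.
  move=> /(_ le)[E|E]; rewrite E in fj.
    by move: na; rewrite (found_inj fu fj) leqNgt lt.
  by move: nb; rewrite (found_inj fw fj) leqNgt lt.
have [le|/ltnW le] := leqP a b; [left|right].
  exact: dfs_tree_le fu fw le (avoid _ _ fu (leqnn a) le).
exact: dfs_tree_le fw fu le (linked_sym (avoid _ _ fw le (leqnn b))).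
Qed.

End DepthFirstTree.

(** * A depth-first tree with every end in its closure *)

Lemma steps_to_sub (V : Type) (G : graph V) (D D' S S' : set V) k w :
  (forall a b, D' a -> D b -> edge G a b -> D' b) -> D' `&` S `<=` S' ->
  D' w -> steps_to G D S k w -> steps_to G D' S' k w.
Proof.
move=> cl sub; elim: k w => [|k IH] w Dw /=; first by move=> Sw; apply: sub.
by move=> [w' [Dw' e /IH nw']]; have := cl _ _ Dw Dw' e; exists w'; split=> //; exact: nw'.
Qed.

Lemma bounded_nondecreasing (f : nat -> nat) h :
  (forall n m, n <= m -> f n <= f m) -> (forall n, f n <= h) ->
  exists n, forall m, n <= m -> f m = f n.
Proof.
move=> mono bd.
have ex : exists k, `[< exists n, f n = k >] by exists (f 0); apply/asboolP; exists 0.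
have [|k /asboolP[n <-] max] := @ex_maxnP _ h ex.
  by move=> k /asboolP[n <-].
exists n => m le; apply/eqP; rewrite eqn_leq (mono n m le) andbT.
by apply: max; apply/asboolP; exists m.
Qed.

Section Covering.
Variables (V : Type) (G : graph V) (x0 : V) (U : nat -> set V).
Hypothesis Gconn : graph_connected G.
Hypothesis Gx0 : verts G x0.
Hypothesis Udisp : forall n, dispersed G (U n).
Hypothesis Ucl : forall r, is_ray G r -> in_cl G r (\bigcup_n U n).

Lemma first_index : exists idx : set V -> nat, forall D n,
  D `&` U n !=set0 -> D `&` U (idx D) !=set0 /\ idx D <= n.
Proof.
have [f fP] : {f : set V -> nat & forall D n,
    D `&` U n !=set0 -> D `&` U (f D) !=set0 /\ f D <= n}.
  apply: (@choice _ _ (fun D k => forall n,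
    D `&` U n !=set0 -> D `&` U k !=set0 /\ k <= n)) => D.
  have [[n hn]|no] := pselect (exists n, D `&` U n !=set0); last first.
    by exists 0 => n hn; case: no; exists n.
  have ex : exists n, `[< D `&` U n !=set0 >] by exists n; apply/asboolP.
  have [m /asboolP hm min] := ex_minnP ex.
  by exists m => k hk; split=> //; apply: min; apply/asboolP.
by exists f.
Qed.

(** Comparing walk lengths rather than distances also covers neighbours that cannot reach [S D]; if
    none can, any neighbour will do. *)
Lemma nearest_pick (S : set V -> set V) : exists pick : set V -> V -> V,
  forall D v, (exists2 w, D w & edge G v w) ->
  [/\ D (pick D v), edge G v (pick D v)
    & forall w k, D w -> edge G v w -> steps_to G D (S D) k w ->
      exists2 j, j <= k & steps_to G D (S D) j (pick D v)].
Proof.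
have [f fP] : {f : set V * V -> V & forall s, (exists2 w, s.1 w & edge G s.2 w) ->
  [/\ s.1 (f s), edge G s.2 (f s)
    & forall w k, s.1 w -> edge G s.2 w -> steps_to G s.1 (S s.1) k w ->
      exists2 j, j <= k & steps_to G s.1 (S s.1) j (f s)]}.
  apply: (@choice _ _ (fun s y => (exists2 w, s.1 w & edge G s.2 w) ->
    [/\ s.1 y, edge G s.2 y
    & forall w k, s.1 w -> edge G s.2 w -> steps_to G s.1 (S s.1) k w ->
      exists2 j, j <= k & steps_to G s.1 (S s.1) j y])) => -[D v] /=.
  have [[w Dw e]|no] := pselect (exists2 w, D w & edge G v w); last by exists v.
  pose Q k := exists y, [/\ D y, edge G v y & steps_to G D (S D) k y].
  have [[k Qk]|nQ] := pselect (exists k, Q k); last first.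
    by exists w => _; split=> // y k Dy ey ny; case: nQ; exists k, y.
  have ex : exists k, `[< Q k >] by exists k; apply/asboolP.
  have [m /asboolP[y [Dy ey ny]] min] := ex_minnP ex.
  exists y => _; split=> // y' k' Dy' ey' ny'; exists m => //.
  by apply: min; apply/asboolP; exists y'.
by exists (fun D v => f (D, v)) => D v; exact: (fP (D, v)).
Qed.

Lemma exists_covering_normal_tree : exists T : graph V,
  normal_tree G T x0 /\ forall r, is_ray G r -> in_cl G r (verts T).
Proof.
have [idx idxP] := first_index.
have [pick pickP] := nearest_pick (fun D => D `&` U (idx D)).
have pickP' D v : (exists2 w, D w & edge G v w) ->
  D (pick D v) /\ edge G v (pick D v) by move=> /pickP[].
pose T := dfs_tree Gconn Gx0 pickP'.
exists T; split; first exact: dfs_normal.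
move=> q qG; apply: contrapT => /not_in_cl[X fX hX].
have [N /(_ N (leqnn N))[EC qN]] := reachE qG fX.
pose z := q N; rewrite -/z in EC qN; rewrite EC in hX qN.
have Gz : verts G z by exact: ray_verts.
(* Visited vertices are in the tree, which avoids the component of [z]; so the search for [z] never
   ends. *)
have alive n : ~ visited G x0 pick z n z.
  elim: n => // n IH [//|/= E]; apply: (hX z qN); exists n; rewrite /= [X in found _ _ _ X]E.
  exact: (current_found Gconn Gx0 pickP').
pose F n := visited G x0 pick z n; pose r n := current G x0 pick z n.
have FT n : F n `<=` verts T.
  move=> w Fw; have [i _ ->] := visitedP Fw; exists i.
  exact: (current_found Gconn Gx0 pickP').
pose D n := cmp G (F n) z.
have CD n : cmp G X z `<=` D n.
  by move=> w /(cmp_avoid hX); apply: linked_del_sub => y /FT; right.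
have Dr n : D n (r n) by exact: (current_cmp Gconn Gx0 pickP').
have re n : edge G (r n) (r n.+1) by exact: (current_edge Gconn Gx0 pickP').
have Dmono n m : n <= m -> D m `<=` D n.
  by move=> le w; apply: linked_del_sub; exact: visited_mono.
have rI : injective r.
  move=> i j E; apply: (@found_inj _ G x0 pick (r i)).
    exact: (current_found Gconn Gx0 pickP').
  by rewrite E; exact: (current_found Gconn Gx0 pickP').
have rG : is_ray G r by [].
have Dstep n a b : D n.+1 a -> (D n `\ r n) b -> edge G a b -> D n.+1 b.
  move=> Da [Db nb] e; apply: linked_edge (Da) _; split=> //.
    by have [] := cmp_end Da.
  by move=> [Fb|//]; have [] := cmp_end Db.
(* Every [D n] contains the component of [z] in [G - X], which meets [U h]; so [h] bounds the chosen
   indices. *)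
have [h Ch] : exists h, cmp G X z `&` U h !=set0.
  have [v rv [h _ Uv]] := Ucl qG fX; exists h, v; split=> //.
  by rewrite -EC.
have Dh n : D n `&` U h !=set0.
  by have [v [/(CD n) Dv Uv]] := Ch; exists v.
have [|n|n1 hn1] := @bounded_nondecreasing (fun n => idx (D n)) h.
- move=> n m le; have [[v [Dv Uv]] _] := idxP _ _ (Dh m).
  by have [] := idxP (D n) (idx (D m)); first by exists v; split=> //; exact: Dmono Dv.
- by have [] := idxP _ _ (Dh n).
pose i := idx (D n1).
have Ei n : n1 <= n -> idx (D n) = i by exact: hn1.
apply: (@Udisp i r rG) => Y fY.
(* From [n2] on, a vertex of [Y] still in [D n] stays in forever, so every vertex outside [D n.+1]
   but in [D n] avoids [Y]. *)
have [|n2 hn2] := @finite_eventually _ Y (fun x n => D n x -> forall m, D m x) fY.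
  move=> x _; have [all|/existsNP[m nm]] := pselect (forall m, D m x).
    by exists 0.
  by exists m => n le /(Dmono _ _ le).
have [n3 hn3] := ray_avoid rI fY.
pose n0 := maxn n1 (maxn n2 n3).
have [le1 le2 le3] : [/\ n1 <= n0, n2 <= n0 & n3 <= n0].
  by rewrite !leq_max !leqnn ?orbT; split.
(* A shortest path in [D n] from [r n] to [U i] either continues in [D n.+1],
   and then the distance to [U i] drops, or avoids [D n.+1], hence [Y]. *)
have main k n : n0 <= n -> steps_to G (D n) (D n `&` U i) k (r n) ->
    exists2 m, n0 <= m & exists2 u, U i u & linked (del G Y) (r m) u.
  elim/ltn_ind: k n => k IH n len nk.
  have [|k' [nk' min]] := @steps_to_min _ G (D n) (D n `&` U i) (r n).
    by exists k.
  have nY : ~ Y (r n) by apply: hn3; exact: leq_trans len.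
  case: k' nk' min => [[_ Ur] _|j [w [Dw e nw]] min].
    exists n => //; exists (r n) => //; apply: linked_refl; split=> //.
    exact: ray_verts.
  have Dw' : (D n `\ r n) w.
    by split=> // E; apply: (@edge_irrefl _ G w); rewrite {1}E.
  have {}nw : steps_to G (D n `\ r n) (D n `&` U i) j w.
    apply: steps_to_avoid nw _ => l le /min; rewrite leqNgt ltnS.
    by rewrite le.
  have [Dw1|nDw1] := pselect (D n.+1 w).
    have Ei1 : idx (D n.+1) = i.
      by apply: Ei; apply: leq_trans le1 _; exact: leqW.
    have nw1 : steps_to G (D n.+1) (D n.+1 `&` U (idx (D n.+1))) j w.
      apply: steps_to_sub nw => //; first exact: Dstep.
      by rewrite Ei1 => v [Dv []].
    have [_ _ /(_ w j Dw1 e nw1)[l lel nl]] :=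
      pickP (D n.+1) (r n) (ex_intro2 _ _ w Dw1 e).
    rewrite Ei1 in nl; apply: (IH l _ n.+1) => //; last exact: leqW.
    by apply: leq_ltn_trans lel _; exact: min nk.
  have Gw := edge_verts (edge_sym e).
  have [u [_ Uu] l] := steps_to_linked Gw Dw' nw.
  have outY v : (D n `\ r n) v -> ~ D n.+1 v -> ~ Y v.
    move=> [Dv _] nDv Yv; apply: nDv; apply: (hn2 n _ v Yv Dv).
    exact: leq_trans len.
  exists n => //; exists u => //.
  apply: (@linked_trans _ _ _ w); first by apply: edge_linked; split=> //; exact: outY.
  suff [] : ~ D n.+1 u /\ linked (del G Y) w u by [].
  apply: (@linked_ind _ _ _ _ [set v | ~ D n.+1 v /\ linked (del G Y) w v] l).
    by split=> //; apply: linked_refl; split=> //; exact: outY.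
  move=> a b [nDa wa] [eab /contrapT Da /contrapT Db].
  have nDb : ~ D n.+1 b by move=> Db1; apply: nDa; apply: Dstep Db1 Da _; exact: edge_sym.
  by split=> //; apply: linked_edge wa _; split=> //; exact: outY.
have [v [Dv Uv]] : D n0 `&` U i !=set0.
  by rewrite -(Ei _ le1); have [] := idxP _ _ (Dh n0).
have [k nk] : exists k, steps_to G (D n0) (D n0 `&` U i) k (r n0).
  by apply: linked_steps_to (cmp_conn (Dr n0) Dv) _.
have [m lem [u Uu l]] := main k n0 (leqnn _) nk.
exists u => //; apply: (@reach_tail _ _ _ _ _ n0) => //; first by exists m.
by move=> m' le; apply: hn3; exact: leq_trans le.
Qed.

End Covering.

(** * Local normal trees *)
Lemma end_nbhs_basic (V : Type) (G : graph V) (w : ends G) A : nbhs w A ->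
  exists X C, [/\ finite_set X, is_component (del G X) C, end_basic G C w
    & end_basic G C `<=` A].
Proof.
rewrite nbhsE => -[B [oB wB] BA].
have [I sI EB] := oB; rewrite -EB in wB BA.
have [[X C] Ii wC] := wB; have [fX _ cC] := sI _ Ii.
by exists X, C; split=> // w' w'C; apply: BA; exists (X, C).
Qed.

Lemma end_boundary_in_cl (V : Type) (G H : graph V) r (rG : is_ray G r) :
  end_boundary G H (end_of rG) -> in_cl G r (verts H).
Proof.
move=> bd X fX; pose Y := X `&` verts G.
have fY : finite_set Y by apply: sub_finite_set fX => w [].
have YG : Y `<=` verts G by move=> w [].
have [v [Cv Hv]] := bd Y fY YG; exists v => //.
have [[u _ EC] /(_ r)] := end_compP (end_of rG) fY YG.
case=> [|N hN]; first by split=> //; exact: ray_equiv_refl.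
exists N => m /hN; rewrite EC in Cv * => um; apply: linked_delI.
exact: linked_trans (linked_sym um) Cv.
Qed.

(** The levels of [T] are the witness: the component [reach X r] is the [C] of a basic neighbourhood
    inside the boundary of [T], and a ray with a tail in [C] has its end in that neighbourhood. *)
Lemma local_tree_good (V : Type) (G T : graph V) x0 r (rG : is_ray G r) :
  normal_tree G T x0 -> nbhs (end_of rG) (end_boundary G T) ->
  exists2 X, finite_set X & good G (reach G X r).
Proof.
move=> nT /end_nbhs_basic[X [C [fX [u Gu EC] rC CT]]].
have [U dU TU] := normal_tree_levels nT; exists X => //.
exists U; split=> // s sG [N hN]; apply: (in_clS TU).
apply: (@end_boundary_in_cl _ _ _ _ sG); apply: CT => t [tG st].
have {}rC : tail_in r C by apply: rC; split=> //; exact: ray_equiv_refl.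
have [M hM] := rC; have [K hK] := reachE rG fX.
have [E rm] := hK (maxn M K) (leq_maxr _ _).
have {E} EC' : C = reach G X r.
  have := hM (maxn M K) (leq_maxl _ _); rewrite E EC => um.
  exact: (@cmp_eq _ G X u).
have fXG : finite_set (X `&` verts G) by apply: sub_finite_set fX => w [].
have [|L hL] := ray_equiv_linked sG tG st fXG; first by move=> w [].
exists L => m le; rewrite EC'.
have sm := hN (maxn N L) (leq_maxl _ _).
rewrite (reach_cmp rG fX sm); apply: linked_delI; apply: hL => //.
exact: leq_maxr.
Qed.

Theorem theorem4p4 (V : Type) (G : graph V)
  (hconn : graph_connected G)
  (hloc : forall w : ends G,
     exists (T : graph V) (x0 : V),
       normal_tree G T x0 /\ nbhs w (end_boundary G T)) :
  exists (T : graph V) (x0 : V), normal_tree G T x0 /\ end_faithful T G.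
Proof.
have lg r : is_ray G r -> exists2 X, finite_set X & good G (reach G X r).
  move=> rG; have [T [y [nT nb]]] := hloc (end_of rG).
  exact: local_tree_good nT nb.
have [[x0 Gx0] conn] := hconn.
(* With nothing deleted the component of [x0] is all of [G]. *)
have [U [dU cU]] := region_good lg (@finite_set0 _) Gx0 id.
have [r rG|T [nT cT]] := @exists_covering_normal_tree _ G x0 U hconn Gx0 dU.
  apply: cU => //; exists 0 => m _.
  apply: sub_linked (conn _ _ Gx0 (ray_verts m rG)).
  by split=> [a Ga|a b e]; split.
by exists T, x0; split=> //; exact: normal_tree_end_faithful nT cT.
Qed.
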